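(* There is a universal constant $c>0$ such that, for $n\ge2$, $\varepsilon\in(0,1)$, $\delta\in(0,1)$, there is no $\delta$-correct stopping rule $T$ for testing $\mathcal{D}_1=\mathcal{D}_2$ versus $\mathrm{TV}(\mathcal{D}_1,\mathcal{D}_2)>\varepsilon$ such that both $$\mathbb{P}\left(\tau_2(T,\mathcal{D}_1,\mathcal{D}_2)\le c\frac{\sqrt{n\log(1/(3\delta))}}{\mathrm{TV}(\mathcal{D}_1,\mathcal{D}_2)^2}\right)\ge1-\delta\ \text{ whenever }\mathrm{TV}(\mathcal{D}_1,\mathcal{D}_2)>\varepsilon,$$ and $$\mathbb{P}\left(\tau_1(T,\mathcal{D}_1,\mathcal{D}_2)\le c\frac{\sqrt{n\log(1/(3\delta))}}{\varepsilon^2}\right)\ge1-\delta\ \text{ whenever }\mathcal{D}_1=\mathcal{D}_2.$$ Similar statements hold when $\frac{\sqrt{n\log(1/(3\delta))}}{(\varepsilon\vee\mathrm{TV}(\mathcal{D}_1,\mathcal{D}_2))^2}$ is replaced by $\frac{\log(1/(3\delta))}{(\varepsilon\vee\mathrm{TV}(\mathcal{D}_1,\mathcal{D}_2))^2}$ or by $\frac{n^{2/3}\log(1/(3\delta))^{1/3}}{(\varepsilon\vee\mathrm{TV}(\mathcal{D}_1,\mathcal{D}_2))^{4/3}}$.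
   Context: Distributions are on $[n]=\{1,\dots,n\}$, $\mathrm{TV}(\mathcal{D},\mathcal{D}')=\frac12\sum_i|\mathcal{D}_i-\mathcal{D}'_i|$, $a\vee b=\max(a,b)$. A stopping rule for closeness is $T:\bigcup_k[n]^k\times[n]^k\to\{0,1,2\}$ with $T(x,y)\ne0\Rightarrow T(xz,yw)=T(x,y)$ whenever $|x|=|y|$, $|z|=|w|$. With $x_1,\dots$ i.i.d. from $\mathcal{D}_1$ and $y_1,\dots$ i.i.d. from $\mathcal{D}_2$, $\tau_j(T,\mathcal{D}_1,\mathcal{D}_2)=\inf\{t:T(x_1\cdots x_t,y_1\cdots y_t)=j\}$. $T$ is $\delta$-correct if $\mathbb{P}(\tau_2\le\tau_1)\le\delta$ when $\mathcal{D}_1=\mathcal{D}_2$ and $\mathbb{P}(\tau_1\le\tau_2)\le\delta$ when $\mathrm{TV}(\mathcal{D}_1,\mathcal{D}_2)>\varepsilon$.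
   Formalization: For the n^{2/3} rate, c may depend on an upper bound ε0<1 of ε (uniform over ε≤ε0): a universal c fails as ε→1, where O(√n) samples suffice by looking for cross-collisions x_i=y_j. For δ>1/3 the square root of a negative number is read as 0 and the cube root as the real one. *)

(* Defs.v *)
From HB Require Import structures.
From mathcomp Require Import all_boot all_order all_algebra.
From mathcomp Require Import all_classical all_reals all_analysis.

Set Implicit Arguments.
Unset Strict Implicit.
Unset Printing Implicit Defensive.

Import Order.TTheory GRing.Theory Num.Theory.

Local Open Scope classical_set_scope.
Local Open Scope ring_scope.

Record distr (R : realType) (n : nat) := Distr {
  mass :> 'I_n -> R;
  mass_ge0 : forall i, 0 <= mass i;
  mass_sum1 : \sum_(i < n) mass i = 1 }.

Definition TV (R : realType) (n : nat) (D D' : distr R n) : R :=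
  2^-1 * \sum_(i < n) `|D i - D' i|.

Definition mutually_independent (d : measure_display) (Omega : measurableType d)
    (R : realType) (P : probability Omega R) (I : eqType) (n : nat)
    (Z : I -> Omega -> 'I_n) : Prop :=
  forall (J : seq I) (A : I -> set 'I_n), uniq J ->
    P [set w | forall i, i \in J -> A i (Z i w)] =
    (\prod_(i <- J) P (Z i @^-1` A i))%E.

(* A probability space carrying x_1, x_2, ... i.i.d. from D1 and y_1, y_2, ...
   i.i.d. from D2, the two sequences being independent of each other: [inl i]
   indexes the x's and [inr i] the y's, both counted from 0. *)
Record iid_samples (R : realType) (n : nat) (D1 D2 : distr R n) := IidSamples {
  sdisp : measure_display;
  Omega : measurableType sdisp;
  Pr : probability Omega R;
  obs : nat + nat -> Omega -> 'I_n;
  obs_measurable : forall s (A : set 'I_n), measurable (obs s @^-1` A);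
  obs_lawx : forall i a, Pr (obs (inl i) @^-1` [set a]) = (D1 a)%:E;
  obs_lawy : forall i a, Pr (obs (inr i) @^-1` [set a]) = (D2 a)%:E;
  obs_indep : mutually_independent Pr obs }.

(* One arbitrary realization of the sampling experiment for each pair (D1, D2);
   the events considered below have probabilities depending only on (D1, D2). *)
Definition sampling (R : realType) (n : nat) : Type :=
  forall D1 D2 : distr R n, iid_samples D1 D2.

Record stopping_rule (n : nat) := StoppingRule {
  decision :> forall k : nat, k.-tuple 'I_n -> k.-tuple 'I_n -> 'I_3;
  decision_stable : forall (k l : nat) (x y : k.-tuple 'I_n)
    (z w : l.-tuple 'I_n), decision x y <> 0%N :> nat ->
    decision (cat_tuple x z) (cat_tuple y w) = decision x y }.

(* Equal to +oo when the set of times is empty. *)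
Definition tau (R : realType) (n : nat) (j : nat) (T : stopping_rule n)
    (D1 D2 : distr R n) (S : iid_samples D1 D2) (w : Omega S) : \bar R :=
  ereal_inf [set (t%:R)%:E | t in [set t : nat |
    T t [tuple obs (inl (val i)) w | i < t]
        [tuple obs (inr (val i)) w | i < t] = j :> nat]].

Definition delta_correct (R : realType) (n : nat) (S : sampling R n)
    (eps delta : R) (T : stopping_rule n) : Prop :=
  (forall D : distr R n,
     (Pr (S D D) [set w | tau 2 T w <= tau 1 T w] <= delta%:E)%E) /\
  (forall D1 D2 : distr R n, eps < TV D1 D2 ->
     (Pr (S D1 D2) [set w | tau 1 T w <= tau 2 T w] <= delta%:E)%E).

(* [bound r] is the target number of samples at r = max(eps, TV(D1, D2)). *)
Definition stops_within (R : realType) (n : nat) (S : sampling R n)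
    (eps delta : R) (T : stopping_rule n) (bound : R -> R) : Prop :=
  (forall D1 D2 : distr R n, eps < TV D1 D2 ->
     ((1 - delta)%:E <=
      Pr (S D1 D2) [set w | tau 2 T w <= (bound (TV D1 D2))%:E])%E) /\
  (forall D : distr R n,
     ((1 - delta)%:E <=
      Pr (S D D) [set w | tau 1 T w <= (bound eps)%:E])%E).

(* The odd real cube root; [powR] alone is not it on negative numbers. *)
Definition cbrt (R : realType) (x : R) : R := Num.sg x * `|x| `^ 3^-1.

(* Main.v *)
(* Stability of T makes {tau_1 <= b} the event that T answers 1 after m = floor b
   samples, and on that event tau_1 <= tau_2.  So T yields a test with m samples
   that errs with probability at most delta both on equal pairs and on far pairs.
   If P_0 and P_1 are mixtures of equal, resp. far, pairs, Cauchy-Schwarz gives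
   (1 - delta)^2 <= delta * sum P_1^2 / P_0, and the right-hand side is at most 1/3
   as soon as log (sum P_1^2 / P_0) <= log (1 / (3 delta)).

   The symbols come in pairs (u, b) of index u and bit b.  A set H of indices is
   heavy, the others light; P_0 makes both bits of a pair equally likely, while in
   P_1 every light u carries a random sign sigma_u, and the bits of the x's are
   biased by + s sigma_u, those of the y's by - s sigma_u.  The indices have the
   same law under P_0 and P_1, and the second moment of the likelihood ratio given
   the indices involves two posterior replicas of H:
     E_{H, H', sigma, sigma'} prod_t (1 + s^2 sigma_{v_t} sigma'_{v_t} [v_t light twice]).
   With no heavy index this gives the log / eps^2 and sqrt (n log) / eps^2 bounds.
   For the n^(2/3) bound, H is a uniform 4m-subset of the indices and s = 1: only
   indices seen twice contribute, and exchanging such an index with an unseen heavy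
   one shows that it is light with posterior probability O(n / m) (light / heavy)^c,
   where c is its number of occurrences.  As at most m indices are seen twice, this
   bounds the second moment for every sequence of indices.  In the remaining range,
   log (1 / (3 delta)) >= C n eps^4, the n^(2/3) bound is dominated by the sqrt one. *)
Require Import Defs.
From HB Require Import structures.
From mathcomp Require Import all_boot all_order all_algebra.
From mathcomp Require Import all_classical all_reals all_analysis.
From mathcomp Require Import ring lra zify.

Import Order.TTheory GRing.Theory Num.Theory.

Set Implicit Arguments.
Unset Strict Implicit.
Unset Printing Implicit Defensive.

Local Open Scope ring_scope.

(** * Second moment method *)

(** Twice the inequality is a double sum over pairs (z, y), in which the two sides differ termwise
    by a square divided by [g z * g y]. *)
Lemma cauchy_schwarz_div (R : realFieldType) (Z : finType) (B : pred Z) (F g : Z -> R) :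
  (forall z, 0 < g z) ->
  (\sum_(z | B z) F z) ^+ 2 <=
  (\sum_(z | B z) g z) * \sum_(z | B z) F z ^+ 2 / g z.
Proof.
move=> g0.
have twice : 2 * (\sum_(z | B z) F z) ^+ 2 <=
    2 * ((\sum_(z | B z) g z) * \sum_(z | B z) F z ^+ 2 / g z).
  have -> : 2 * (\sum_(z | B z) F z) ^+ 2 =
      \sum_(z | B z) \sum_(y | B y) 2 * (F z * F y).
    rewrite expr2 mulr_suml mulr_sumr; apply: eq_bigr => z _.
    by rewrite !mulr_sumr; apply: eq_bigr.
  have -> : 2 * ((\sum_(z | B z) g z) * \sum_(z | B z) F z ^+ 2 / g z) =
      \sum_(z | B z) \sum_(y | B y)
        (g z * (F y ^+ 2 / g y) + g y * (F z ^+ 2 / g z)).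
    under [RHS]eq_bigr do rewrite big_split /=.
    rewrite big_split /= [X in _ = _ + X]exchange_big /= mulr_suml mulr_natl mulr2n.
    by congr (_ + _); apply: eq_bigr => z _; rewrite mulr_sumr.
  apply: ler_sum => z _; apply: ler_sum => y _.
  have gz := g0 z; have gy := g0 y.
  have -> : g z * (F y ^+ 2 / g y) + g y * (F z ^+ 2 / g z) =
    ((g z * F y) ^+ 2 + (g y * F z) ^+ 2) / (g z * g y).
    by field; rewrite !gt_eqF.
  rewrite ler_pdivlMr ?mulr_gt0 // -subr_ge0.
  have -> : (g z * F y) ^+ 2 + (g y * F z) ^+ 2 - 2 * (F z * F y) * (g z * g y)
     = (g z * F y - g y * F z) ^+ 2 by ring.
  exact: sqr_ge0.
by move: twice; rewrite ler_pM2l // ltr0n.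
Qed.

(** Le Cam's method with a mixture: [K] bounds the second moment of the likelihood ratio of the
    averaged [f th] to [g]. Cauchy-Schwarz is applied on [B], and the second moment is then extended
    to all samples. *)
Lemma mixture_test_bound (R : realFieldType) (Z Th : finType) (A : {set Th}) (B : pred Z)
    (f : Th -> Z -> R) (g : Z -> R) (a b K : R) :
  (0 < #|A|)%N -> (forall z, 0 < g z) -> 0 <= a ->
  (forall th, th \in A -> a <= \sum_(z | B z) f th z) ->
  \sum_(z | B z) g z <= b ->
  \sum_z (\sum_(th in A) f th z) ^+ 2 / g z <= K * #|A|%:R ^+ 2 ->
  a ^+ 2 <= b * K.
Proof.
move=> A0 g0 a0 fa gb fK.
have b0 : 0 <= b by apply: le_trans gb; apply: sumr_ge0 => z _; exact: ltW.
have A2 : 0 < (#|A|%:R : R) ^+ 2 by rewrite exprn_gt0 // ltr0n.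
rewrite -(ler_pM2r A2) -exprMn -mulrA.
have aA : a * #|A|%:R <= \sum_(z | B z) \sum_(th in A) f th z.
  rewrite exchange_big /= mulr_natr -sumr_const; exact: ler_sum.
apply: (le_trans (lerXn2r 2 _ _ aA)); rewrite ?nnegrE ?mulr_ge0 //.
  by apply: le_trans aA; rewrite mulr_ge0.
apply: (le_trans (cauchy_schwarz_div _ _ g0)).
apply: ler_pM => //.
- by apply: sumr_ge0 => z _; exact: ltW.
- by apply: sumr_ge0 => z _; rewrite divr_ge0 ?sqr_ge0 // ltW.
apply: le_trans fK; rewrite [leRHS](bigID B) /= lerDl.
by apply: sumr_ge0 => z _; rewrite divr_ge0 ?sqr_ge0 // ltW.
Qed.

(** * Posterior of the heavy set given the index counts *)

Lemma disjoint_setU1 (U : finType) (u : U) (S H : {set U}) :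
  [disjoint u |: S & H] = (u \notin H) && [disjoint S & H].
Proof. by rewrite !finset.disjoints_subset finset.subUset finset.sub1set finset.in_setC. Qed.

Section Posterior.
Variables (R : realType) (U : finType) (c : U -> nat) (h l : R).
Hypotheses (h0 : 0 < h) (l0 : 0 < l).

(** Likelihood of an index sequence with occurrence counts [c] when the heavy set is [H]. *)
Definition weight (H : {set U}) : R := \prod_u (if u \in H then h else l) ^+ c u.

(** Unnormalised posterior probability that all of [S] is light, for a uniform prior on
    [k]-subsets. *)
Definition avoiding_weight (k : nat) (S : {set U}) : R :=
  \sum_(H : {set U} | (#|H| == k) && [disjoint S & H]) weight H.

Lemma weight_gt0 H : 0 < weight H.
Proof. by apply: prodr_gt0 => u _; rewrite exprn_gt0 //; case: ifP. Qed.

Lemma avoiding_weight_ge0 k S : 0 <= avoiding_weight k S.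
Proof. by apply: sumr_ge0 => H _; exact/ltW/weight_gt0. Qed.

(** The unseen [v] has factor 1 before and after the exchange, so only the factor of [u] changes. *)
Lemma weight_swap u v (H : {set U}) : u \notin H -> v \in H -> c v = 0%N ->
  weight (u |: (H :\ v)) * l ^+ c u = weight H * h ^+ c u.
Proof.
move=> uH vH cv; rewrite /weight [X in X * _](bigD1 u) //=.
rewrite [X in _ = X * _](bigD1 u) //= setU11 (negbTE uH).
rewrite [LHS]mulrAC -[LHS]mulrA [RHS]mulrC; congr (_ * _).
congr (_ * _); apply: eq_bigr => i iu.
rewrite !inE (negbTE iu) /=; case: eqVneq => // ->.
by rewrite cv !expr0.
Qed.

(* Double counting of the exchanges H |-> u |: (H :\ v), where v is one of the at
   least k - q unseen elements of H; for fixed v they are injective. *)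
Lemma avoiding_weightU1 (k q : nat) u (S : {set U}) :
  u \notin S -> (#|[set v | c v != 0%N]| <= q)%N ->
  avoiding_weight k (u |: S) * (k - q)%:R * h ^+ c u <=
  #|U|%:R * l ^+ c u * avoiding_weight k S.
Proof.
move=> uS hq.
pose P := [set H : {set U} | (#|H| == k) && [disjoint u |: S & H]].
have PE H : H \in P -> [/\ #|H| = k, u \notin H & [disjoint S & H]].
  rewrite inE => /andP[/eqP-> ]; rewrite disjoint_setU1 => /andP[-> ->] //.
apply: (@le_trans _ _ (\sum_(H in P) \sum_(v in H | c v == 0%N) weight H * h ^+ c u)).
  have -> : avoiding_weight k (u |: S) = \sum_(H in P) weight H.
    by apply: eq_bigl => H; rewrite inE.
  rewrite -mulrA mulr_suml; apply: ler_sum => H /PE[Hk uH SH].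
  rewrite sumr_const mulrCA -[leRHS]mulr_natl ler_wpM2r //.
    by rewrite mulr_ge0 ?exprn_ge0 ?(ltW (weight_gt0 _)) // ltW.
  rewrite ler_nat leq_subLR -Hk.
  rewrite -(cardID [pred v | c v == 0%N] (mem H)) addnC leq_add //.
    apply: leq_trans hq; apply: subset_leq_card; apply/fintype.subsetP => v.
    by rewrite !inE => /andP[].
rewrite (exchange_big_dep predT) //=.
rewrite -mulrA mulr_natl -sumr_const; apply: ler_sum => v _.
pose Pv := [set H in P | (v \in H) && (c v == 0%N)].
pose sw (H : {set U}) := u |: (H :\ v).
rewrite (eq_bigl (mem Pv)); last by move=> H; rewrite !inE.
rewrite (eq_bigr (fun H => weight (sw H) * l ^+ c u)); last first.
  move=> H; rewrite !inE disjoint_setU1 => /andP[/andP[_ /andP[uH _]] /andP[vH /eqP cv]].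
  by rewrite -(weight_swap uH vH cv).
rewrite -mulr_suml [leRHS]mulrC ler_pM2r ?exprn_gt0 //.
(* Injectivity: removing [u] and putting [v] back recovers [H]. *)
rewrite -(big_imset weight) /=; last first.
  move=> H1 H2; rewrite !inE => /andP[HP1 /andP[v1 _]] /andP[HP2 /andP[v2 _]] E.
  have [_ u1 _] := PE H1 ltac:(by rewrite inE).
  have [_ u2 _] := PE H2 ltac:(by rewrite inE).
  rewrite -(finset.setD1K v1) -(finset.setD1K v2); congr (_ |: _).
  rewrite -[LHS](@finset.setU1K _ u) ?inE ?negb_and ?u1 ?orbT //.
  by rewrite -[RHS](@finset.setU1K _ u) ?inE ?negb_and ?u2 ?orbT // -/(sw H1) E.
rewrite [leRHS](bigID (mem (sw @: Pv))) /=.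
rewrite (eq_bigl (fun H : {set U} => ((#|H| == k) && [disjoint S & H]) && (H \in sw @: Pv))).
  by rewrite lerDl; apply: sumr_ge0 => H _; exact/ltW/weight_gt0.
move=> H; case: imsetP => [[H' + ->]|]; last by rewrite andbF.
rewrite inE andbT => /andP[/PE[Hk uH SH] /andP[vH _]].
rewrite cardsU1 !inE (negbTE uH) andbF /= -Hk (cardsD1 v H') vH eqxx /=.
rewrite disjoint_sym disjoint_setU1 uS disjoint_sym /=; symmetry.
by apply: disjointWr SH; exact: finset.subsetDl.
Qed.

(** Price of requiring [u] to be light as well: [k - q] bounds from below the number of unseen heavy
    indices, and [#|U|] from above the choices of the exchanged one. *)
Definition swap_ratio (k q : nat) (u : U) : R :=
  #|U|%:R / (k - q)%:R * (l / h) ^+ c u.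

(** Induction on the size of [S]: by [avoiding_weightU1], each index removed costs its
    [swap_ratio]. *)
Lemma avoiding_weight_le (k q : nat) (S : {set U}) :
  (#|[set v | c v != 0%N]| <= q)%N -> (q < k)%N ->
  avoiding_weight k S <=
  (\prod_(u in S) swap_ratio k q u) * avoiding_weight k finset.set0.
Proof.
move=> hq qk; have kq : 0 < (k - q)%:R :> R by rewrite ltr0n subn_gt0.
have sw0 u : 0 <= swap_ratio k q u.
  by rewrite mulr_ge0 ?divr_ge0 ?exprn_ge0 ?divr_ge0 // ltW.
have [r] := ubnP #|S|; elim: r S => // r IH S Sr.
have [->|[u uS]] := set_0Vmem S; first by rewrite big_set0 mul1r.
have uS' : u \notin S :\ u by rewrite !inE eqxx.
rewrite -(finset.setD1K uS) big_setU1 //= -mulrA.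
have /(ler_wpM2l (sw0 u)) : avoiding_weight k (S :\ u) <=
    (\prod_(v in S :\ u) swap_ratio k q v) * avoiding_weight k finset.set0.
  by apply: IH; move: Sr; rewrite (cardsD1 u) uS.
apply: le_trans; have := avoiding_weightU1 k uS' hq.
rewrite -mulrA -ler_pdivlMr ?mulr_gt0 ?exprn_gt0 // => /le_trans; apply.
rewrite le_eqVlt; apply/orP; left; apply/eqP; rewrite /swap_ratio expr_div_n.
by field; rewrite !gt_eqF // exprn_gt0.
Qed.

(* Expanding the product over the sets S of indices that are light in both replicas
   decouples H from H'. *)
Lemma weight_replicas (k q : nat) (mu : U -> R) :
  (#|[set v | c v != 0%N]| <= q)%N -> (q < k)%N -> (forall u, 0 <= mu u) ->
  \sum_(H : {set U} | #|H| == k) \sum_(H' : {set U} | #|H'| == k)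
    weight H * weight H' *
      \prod_u (1 + (if (u \notin H) && (u \notin H') then mu u else 0)) <=
  (\sum_(H : {set U} | #|H| == k) weight H) ^+ 2 *
    \prod_u (1 + mu u * swap_ratio k q u ^+ 2).
Proof.
move=> hq qk mu0.
pose chi (H S : {set U}) : R := [disjoint S & H]%:R.
have -> : \sum_(H : {set U} | #|H| == k) \sum_(H' : {set U} | #|H'| == k)
    weight H * weight H' *
      \prod_u (1 + (if (u \notin H) && (u \notin H') then mu u else 0)) =
  \sum_(S : {set U}) (\prod_(u in S) mu u) * avoiding_weight k S ^+ 2.
  have avE S : avoiding_weight k S = \sum_(H : {set U} | #|H| == k) weight H * chi H S.
    rewrite /avoiding_weight big_mkcondr; apply: eq_bigr => H _.
    by rewrite /chi; case: ifP => _; rewrite ?mulr1 ?mulr0.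
  have -> : \sum_(S : {set U}) (\prod_(u in S) mu u) * avoiding_weight k S ^+ 2 =
      \sum_(S : {set U}) \sum_(H : {set U} | #|H| == k) \sum_(H' : {set U} | #|H'| == k)
        weight H * weight H' * (chi H S * chi H' S * \prod_(u in S) mu u).
    apply: eq_bigr => S _; rewrite avE expr2 mulr_suml mulr_sumr; apply: eq_bigr => H _.
    rewrite !mulr_sumr; apply: eq_bigr => H' _; ring.
  rewrite [RHS]exchange_big /=; apply: eq_bigr => H _.
  rewrite [RHS]exchange_big /=; apply: eq_bigr => H' _.
  rewrite -mulr_sumr; congr (_ * _).
  under eq_bigr do rewrite addrC.
  rewrite bigA_distr /=; apply: eq_bigr => S _; rewrite -big_mkcond /= /chi.
  case: (boolP [disjoint S & H]) => [SH|]; last first.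
    rewrite -finset.setI_eq0 => /set0Pn[u /setIP[uS uH]].
    by rewrite (bigD1 u) //= uH /= !mul0r.
  case: (boolP [disjoint S & H']) => [SH'|]; last first.
    rewrite -finset.setI_eq0 => /set0Pn[u /setIP[uS uH]].
    by rewrite (bigD1 u) //= uH andbF /= mulr0 !mul0r.
  rewrite !mul1r; apply: eq_bigr => u uS.
  by rewrite (disjointFr SH uS) (disjointFr SH' uS).
have -> : \prod_u (1 + mu u * swap_ratio k q u ^+ 2) =
    \sum_(S : {set U}) \prod_(u in S) (mu u * swap_ratio k q u ^+ 2).
  under eq_bigr do rewrite addrC.
  by rewrite bigA_distr; apply: eq_bigr => S _; rewrite -big_mkcond.
have -> : \sum_(H : {set U} | #|H| == k) weight H = avoiding_weight k finset.set0.
  by apply: eq_bigl => H; rewrite -finset.setI_eq0 finset.set0I eqxx andbT.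
rewrite mulr_sumr; apply: ler_sum => S _.
rewrite big_split /= [leRHS]mulrCA ler_wpM2l ?prodr_ge0 //.
rewrite prodrXl -exprMn mulrC lerXn2r ?nnegrE ?avoiding_weight_ge0 //.
  rewrite mulr_ge0 ?avoiding_weight_ge0 // prodr_ge0 // => u _.
  by rewrite mulr_ge0 ?divr_ge0 ?exprn_ge0 ?divr_ge0 // ltW.
exact: avoiding_weight_le.
Qed.
End Posterior.

(** * Tests with a fixed number of samples, and pushforwards of finite laws *)

Definition side {A : Type} {m : nat} (x y : A) (t : 'I_m + 'I_m) : A :=
  if t is inl _ then x else y.

(** [B] is the region where equality is rejected; its probabilities are finite sums over samples of
    [2m] symbols. *)
Definition separates (R : realType) (n m : nat) (eps delta : R)
    (B : pred {ffun 'I_m + 'I_m -> 'I_n}) : Prop :=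
  (forall D : distr R n, \sum_(z | B z) \prod_t D (z t) <= delta) /\
  (forall D1 D2 : distr R n, eps < TV D1 D2 ->
     1 - delta <= \sum_(z | B z) \prod_t side D1 D2 t (z t)).

Section Pushforward.
Variables (R : realType) (n : nat) (A : finType) (enc : A -> 'I_n).

Definition pushforward (d : A -> R) (i : 'I_n) : R := \sum_(a | enc a == i) d a.

Lemma pushforward_ge0 d : (forall a, 0 <= d a) -> forall i, 0 <= pushforward d i.
Proof. by move=> d0 i; apply: sumr_ge0. Qed.

Lemma sum_pushforward d : \sum_i pushforward d i = \sum_a d a.
Proof. by rewrite [RHS](partition_big enc predT). Qed.

Definition pushforward_distr d (d0 : forall a, 0 <= d a) (d1 : \sum_a d a = 1) : distr R n :=
  Distr (pushforward_ge0 d0) (etrans (sum_pushforward d) d1).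

(** By injectivity each fibre of [enc] is empty or a single point, so nothing cancels inside a
    fibre. *)
Lemma TV_pushforward (enc_inj : injective enc) d d' d0 d1 d0' d1' :
  TV (@pushforward_distr d d0 d1) (@pushforward_distr d' d0' d1') =
  2^-1 * \sum_a `|d a - d' a|.
Proof.
rewrite /TV; congr (_ * _); rewrite [RHS](partition_big enc predT) //=.
apply: eq_bigr => i _; rewrite /pushforward -sumrB.
have [[a <-]|noa] := pselect (exists a, enc a = i).
  have encE : (fun a' => enc a' == enc a) =1 pred1 a by move=> a'; rewrite (inj_eq enc_inj).
  by rewrite !(eq_bigl _ _ encE) !big_pred1_eq.
by rewrite !big_pred0 ?normr0 // => a; apply/negP => /eqP ai; apply: noa; exists a.
Qed.

Lemma sum_prod_pushforward (I : finType) (B : pred {ffun I -> 'I_n}) (d : I -> A -> R) :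
  \sum_(z | B z) \prod_t pushforward (d t) (z t) =
  \sum_(x : {ffun I -> A} | B [ffun t => enc (x t)]) \prod_t d t (x t).
Proof.
rewrite [RHS](partition_big (fun x : {ffun I -> A} => [ffun t => enc (x t)]) B) //=.
apply: eq_bigr => z Bz; rewrite (bigA_distr_big_dep (fun t a => enc a == z t)); apply: eq_bigl => x.
apply/familyP/andP => [xz|[_ /eqP <-] t]; last by rewrite unfold_in ffunE.
have xE : [ffun t => enc (x t)] = z.
  by apply/ffunP => t; rewrite ffunE; apply/eqP; have := xz t.
by rewrite xE eqxx.
Qed.
End Pushforward.

(** * The model of paired symbols *)

Section PairModel.
Variables (R : realType) (U : finType) (s h l : R).
Hypotheses (s01 : 0 <= s <= 1) (h0 : 0 < h) (l0 : 0 < l).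

Definition pair_mass (H : {set U}) (u : U) : R := if u \in H then h else l.

Definition signal (H : {set U}) (sigma : {ffun U -> bool}) (u : U) : R :=
  if u \in H then 0 else (-1) ^+ sigma u.

(* The bit e is false for the x's and true for the y's. *)
Definition pair_law H sigma (e : bool) (a : U * bool) : R :=
  pair_mass H a.1 / 2 * (1 + s * signal H sigma a.1 * (-1) ^+ (e (+) a.2)).

Lemma pair_mass_gt0 H u : 0 < pair_mass H u.
Proof. by rewrite /pair_mass; case: ifP. Qed.

Lemma pair_law_ge0 H sigma e a : 0 <= pair_law H sigma e a.
Proof.
rewrite mulr_ge0 ?divr_ge0 ?(ltW (pair_mass_gt0 _ _)) // /signal.
case/andP: s01 => s0 s1; case: ifP => _; first by rewrite mulr0 mul0r addr0.
by case: (sigma _); case: (e (+) _); rewrite !(expr0, expr1); lra.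
Qed.

Lemma sum_pair_law H sigma e u :
  pair_law H sigma e (u, true) + pair_law H sigma e (u, false) = pair_mass H u.
Proof. by rewrite /pair_law /=; case: e; rewrite !(expr0, expr1) /=; field. Qed.

Lemma sum_pairs (F : U * bool -> R) :
  \sum_a F a = \sum_u (F (u, true) + F (u, false)).
Proof.
rewrite (eq_bigr (fun a => F (a.1, a.2))) => [|[]//].
rewrite -(pair_bigA _ (fun u b => F (u, b))) /=.
by apply: eq_bigr => u _; rewrite big_bool.
Qed.

(** Each of the two bits of a light index contributes [s * l] in absolute value, and heavy indices
    contribute nothing. *)
Lemma pair_law_dist H sigma :
  2^-1 * \sum_a `|pair_law H sigma false a - pair_law H sigma true a| =
  s * l *+ #|~: H|.
Proof.
have diffE a : `|pair_law H sigma false a - pair_law H sigma true a| =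
    if a.1 \in H then 0 else s * l.
  have -> : pair_law H sigma false a - pair_law H sigma true a =
      pair_mass H a.1 * s * signal H sigma a.1 * (-1) ^+ a.2.
    by rewrite /pair_law /=; case: a.2; rewrite !(expr0, expr1) /=; field.
  rewrite /signal /pair_mass; case: ifP => _; first by rewrite mulr0 mul0r normr0.
  case/andP: s01 => s0 _; rewrite !normrM !normr_sign !mulr1.
  by rewrite (ger0_norm s0) gtr0_norm // mulrC.
rewrite sum_pairs mulr_sumr -sumr_const [LHS](bigID (mem H)) /= big1 ?add0r.
  by apply: eq_big => u; rewrite ?inE // !diffE /= => /negbTE ->; field.
by move=> u uH; rewrite !diffE /= uH; field.
Qed.

(** The terms linear in [s] cancel between the two bits and the sign coming from [e] is squared
    away, so the x's and the y's contribute alike. *)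
Lemma pair_law_corr H H' sigma sigma' e u :
  pair_law H sigma e (u, true) * pair_law H' sigma' e (u, true) +
  pair_law H sigma e (u, false) * pair_law H' sigma' e (u, false) =
  pair_mass H u * pair_mass H' u / 2 *
    (1 + s ^+ 2 * (signal H sigma u * signal H' sigma' u)).
Proof. by rewrite /pair_law /=; case: e; rewrite !(expr0, expr1) /=; field. Qed.
End PairModel.

(** * Likelihood ratio of the mixture over heavy sets and signs *)

Section PairTest.
Variables (R : realType) (n m : nat) (U : finType).
Variables (s h l eps delta K : R) (Hs : {set {set U}}).
Hypotheses (s01 : 0 <= s <= 1) (h0 : 0 < h) (l0 : 0 < l).

Let I : finType := ('I_m + 'I_m)%type.

Lemma sum_prod_fiber (F : I -> U * bool -> R) (v : {ffun I -> U}) :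
  \sum_(x : {ffun I -> U * bool} | [ffun t => (x t).1] == v) \prod_t F t (x t) =
  \prod_t (F t (v t, true) + F t (v t, false)).
Proof.
have -> : \prod_t (F t (v t, true) + F t (v t, false)) =
    \prod_t \sum_(a | a.1 == v t) F t a.
  apply: eq_bigr => t _; rewrite [RHS]big_mkcond sum_pairs (bigD1 (v t)) //= eqxx.
  by rewrite big1 ?addr0 // => u /negbTE ->; rewrite addr0.
rewrite (bigA_distr_big_dep (fun t (a : U * bool) => a.1 == v t)); apply: eq_bigl => x.
apply/eqP/familyP => [<- t|xv]; first by rewrite unfold_in ffunE.
by apply/ffunP => t; rewrite ffunE; apply/eqP; exact: xv.
Qed.

Definition index_weight (H : {set U}) (v : {ffun I -> U}) : R :=
  \prod_t pair_mass h l H (v t).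

(** [#|Hs|] times the likelihood of the indices [v], which is the same for the null and the
    alternative mixture. *)
Definition evidence (v : {ffun I -> U}) : R := \sum_(H in Hs) index_weight H v.

(** The replicas are (H, sigma) and (H', sigma'); [sigma] stays fixed because the bounds below hold
    for each of its values. *)
Definition replica_sum (sigma : {ffun U -> bool}) (v : {ffun I -> U}) : R :=
  \sum_(H in Hs) \sum_(H' in Hs) index_weight H v * index_weight H' v *
    \sum_sigma' \prod_t
      (1 + s ^+ 2 * (signal R H sigma (v t) * signal R H' sigma' (v t))).

Lemma index_weight_gt0 H v : 0 < index_weight H v.
Proof. by apply: prodr_gt0 => t _; exact: pair_mass_gt0. Qed.

Lemma evidence_gt0 v : (0 < #|Hs|)%N -> 0 < evidence v.
Proof.
case/card_gt0P => H HHs; rewrite /evidence (bigD1 H) //=.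
by rewrite ltr_wpDr ?index_weight_gt0 ?sumr_ge0 // => H' _; exact/ltW/index_weight_gt0.
Qed.

Let law (th : {set U} * {ffun U -> bool}) (x : {ffun I -> U * bool}) : R :=
  \prod_t pair_law s h l th.1 th.2 (side false true t) (x t).

Let null (x : {ffun I -> U * bool}) : R :=
  #|Hs|%:R^-1 * \sum_(H in Hs) \prod_t (pair_mass h l H (x t).1 / 2).

Let models := [set th : {set U} * {ffun U -> bool} | th.1 \in Hs].

Let card_models : #|models| = (#|Hs| * 2 ^ #|U|)%N.
Proof.
have -> : models = finset.setX Hs [set: {ffun U -> bool}] by apply/setP => th; rewrite !inE andbT.
by rewrite cardsX cardsT card_ffun card_bool.
Qed.

Let sum_models (F : {set U} * {ffun U -> bool} -> R) :
  \sum_(th in models) F th = \sum_(H in Hs) \sum_sigma F (H, sigma).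
Proof.
rewrite (pair_big (mem Hs) predT (fun H sigma => F (H, sigma))) /=.
by apply: eq_big => [[H sigma]|[H sigma] _] //=; rewrite !inE andbT.
Qed.

Let second_moment : (0 < #|Hs|)%N ->
  \sum_x (\sum_(th in models) law th x) ^+ 2 / null x =
  #|Hs|%:R * \sum_sigma \sum_v replica_sum sigma v / evidence v.
Proof.
move=> Hs0; have HsR : #|Hs|%:R != 0 :> R by rewrite pnatr_eq0 -lt0n.
rewrite (partition_big (fun x : {ffun I -> U * bool} => [ffun t => (x t).1]) predT) //=.
rewrite exchange_big /= mulr_sumr; apply: eq_bigr => v _.

(* Null bits are fair, so the null likelihood depends on the indices alone. *)
have nullE (x : {ffun I -> U * bool}) : [ffun t => (x t).1] == v ->
    null x = #|Hs|%:R^-1 * 2 ^- #|I| * evidence v.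
  move=> /eqP <-; rewrite /null -mulrA; congr (_ * _); rewrite mulr_sumr.
  apply: eq_bigr => H _; rewrite big_split /= prodr_const -exprVn mulrC; congr (_ * _).
  by apply: eq_bigr => t _; rewrite ffunE.
rewrite (eq_bigr (fun x => (\sum_(th in models) law th x) ^+ 2 /
    (#|Hs|%:R^-1 * 2 ^- #|I| * evidence v))) => [|x /nullE -> //].
rewrite -!mulr_suml.
(* Expanding the square creates the two replicas; the bits are then summed out position by
   position. *)
have -> : \sum_(x : {ffun I -> U * bool} | [ffun t => (x t).1] == v)
      (\sum_(th in models) law th x) ^+ 2 = 2 ^- #|I| * \sum_sigma replica_sum sigma v.
  transitivity (\sum_(th in models) \sum_(th' in models)
      2 ^- #|I| * (index_weight th.1 v * index_weight th'.1 v) * \prod_t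
      (1 + s ^+ 2 * (signal R th.1 th.2 (v t) * signal R th'.1 th'.2 (v t)))).
    under eq_bigr do rewrite expr2 big_distrlr /=.
    rewrite exchange_big; apply: eq_bigr => th _.
    rewrite exchange_big; apply: eq_bigr => th' _.
    under eq_bigr do rewrite /law -big_split /=.
    rewrite (sum_prod_fiber (fun t a => pair_law s h l th.1 th.2 (side false true t) a *
      pair_law s h l th'.1 th'.2 (side false true t) a)).
    under eq_bigr do rewrite pair_law_corr.
    rewrite big_split /= big_split /= big_split /= prodr_const -exprVn.
    by rewrite mulrC [in RHS]mulrC [X in _ * X]mulrC.
  rewrite sum_models exchange_big /= mulr_sumr; apply: eq_bigr => sigma _.
  rewrite mulr_sumr; apply: eq_bigr => H _.
  rewrite sum_models mulr_sumr; apply: eq_bigr => H' _.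
  by rewrite /= !mulr_sumr; apply: eq_bigr => sigma' _; rewrite !mulrA.
by field; rewrite HsR gt_eqF ?evidence_gt0 ?expf_neq0 ?pnatr_eq0.
Qed.

(** There are [#|Hs| * 2 ^ #|U|] models, so the second moment bound of [mixture_test_bound] follows
    once each [sigma] contributes at most its share. *)
Lemma pair_test_bound (B : pred {ffun 'I_m + 'I_m -> 'I_n}) :
  (#|U| * 2 <= n)%N -> (0 < #|Hs|)%N -> delta < 1 ->
  (forall H, H \in Hs -> \sum_u pair_mass h l H u = 1) ->
  (forall H, H \in Hs -> eps < s * l *+ #|~: H|) ->
  separates eps delta B ->
  (forall sigma, \sum_v replica_sum sigma v / evidence v <= K * #|Hs|%:R * 2 ^+ #|U|) ->
  (1 - delta) ^+ 2 <= delta * K.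
Proof.
move=> Un Hs0 delta1 mass1 far [sep0 sep1] hK.
have cardA : (#|{: U * bool}| <= n)%N by rewrite card_prod card_bool.
pose enc (a : U * bool) : 'I_n := widen_ord cardA (enum_rank a).
have enc_inj : injective enc.
  by move=> a b /(congr1 val) /= /val_inj /enum_rank_inj.
pose B' := [pred x : {ffun I -> U * bool} | B [ffun t => enc (x t)]].
apply: (@mixture_test_bound R _ _ models B' law null).
- by rewrite card_models muln_gt0 Hs0 expn_gt0.
- move=> x; rewrite mulr_gt0 ?invr_gt0 ?ltr0n //.
  have /card_gt0P[H HHs] := Hs0; rewrite (bigD1 H) //=.
  have pos H' : 0 < \prod_t (pair_mass h l H' (x t).1 / 2).
    by apply: prodr_gt0 => t _; rewrite divr_gt0 // pair_mass_gt0.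
  by rewrite ltr_wpDr ?sumr_ge0 // => H' _; exact/ltW/pos.
- by rewrite subr_ge0 ltW.
- case=> H sigma; rewrite inE /= => HHs.
  have law1 e : \sum_a pair_law s h l H sigma e a = 1.
    by rewrite sum_pairs -[RHS](mass1 _ HHs); apply: eq_bigr => u _; exact: sum_pair_law.
  have law0 e a : 0 <= pair_law s h l H sigma e a by exact: pair_law_ge0.
  have := sep1 (pushforward_distr enc (law0 false) (law1 false))
               (pushforward_distr enc (law0 true) (law1 true)).
  rewrite TV_pushforward // pair_law_dist // => /(_ (far _ HHs)) /le_trans; apply.
  rewrite le_eqVlt; apply/orP; left; apply/eqP.
  rewrite -(sum_prod_pushforward enc B (fun t => pair_law s h l H sigma (side false true t))).
  by apply: eq_bigr => z _; apply: eq_bigr => -[] i _.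
(* For fixed [H] the null is an equal pair with fair bits; its error bound is averaged over [Hs]. *)
- rewrite -mulr_sumr exchange_big /= mulrC ler_pdivrMr ?ltr0n // mulr_natr -sumr_const.
  apply: ler_sum => H HHs.
  have half0 (a : U * bool) : 0 <= pair_mass h l H a.1 / 2.
    by rewrite divr_ge0 // ltW // pair_mass_gt0.
  have half1 : \sum_(a : U * bool) pair_mass h l H a.1 / 2 = 1.
    by rewrite sum_pairs -[RHS](mass1 _ HHs); apply: eq_bigr => u _ /=; field.
  have := sep0 (pushforward_distr enc half0 half1).
  by rewrite (sum_prod_pushforward enc B (fun=> fun a => pair_mass h l H a.1 / 2)).
rewrite second_moment // card_models natrM natrX exprMn.
have -> : K * (#|Hs|%:R ^+ 2 * (2 ^+ #|U|) ^+ 2) =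
   #|Hs|%:R * (K * #|Hs|%:R * 2 ^+ #|U| * 2 ^+ #|U|) by ring.
rewrite ler_wpM2l //.
have -> : K * #|Hs|%:R * 2 ^+ #|U| * 2 ^+ #|U| =
    \sum_(sigma : {ffun U -> bool}) K * #|Hs|%:R * 2 ^+ #|U|.
  by rewrite sumr_const card_ffun card_bool -[RHS]mulr_natr natrX.
exact: ler_sum.
Qed.
End PairTest.

(** * Second moment without heavy indices *)

(** Moment generating function of a random sign. If [|a| <= 1/2], then [expR b <= (1 - b)^-1 <= 1 +
    b + 2 * b ^+ 2] for b = a and b = -a, and the linear terms cancel; otherwise
    [b <= 2 * b ^+ 2]. *)
Lemma expR_cosh_le (R : realType) (a : R) : expR a + expR (- a) <= 2 * expR (2 * a ^+ 2).
Proof.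
have quad (b : R) : b <= 2^-1 -> expR b <= 1 + b + 2 * b ^+ 2.
  move=> b2; have pos : 0 < 1 - b by lra.
  rewrite -[b in expR b]opprK expRN; apply: (@le_trans _ _ (1 - b)^-1).
    by rewrite lef_pV2 ?posrE ?expR_gt0 //; have := expR_ge1Dx (- b).
  rewrite -[_^-1]mul1r ler_pdivrMr //.
  have : 0 <= b ^+ 2 * (1 - 2 * b) by rewrite mulr_ge0 ?sqr_ge0 //; lra.
  by rewrite !expr2; nra.
have big (b : R) : 2^-1 <= `|b| -> expR b <= expR (2 * b ^+ 2).
  move=> b2; rewrite ler_expR -real_normK ?num_real //.
  by have := ler_norm b; rewrite expr2; nra.
have [a2|/ltW a2] := leP (`|a|) 2^-1.
  move: a2; rewrite ler_norml => /andP[a1 a2].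
  have := expR_ge1Dx (2 * a ^+ 2); have := quad _ a2; have := quad (- a).
  by rewrite sqrrN => /(_ ltac:(lra)); lra.
by have := big _ a2; have := big (- a); rewrite normrN sqrrN => /(_ a2); lra.
Qed.

Section UniformReplicas.
Variables (R : realType) (m : nat) (U : finType) (s : R).
Hypotheses (U0 : (0 < #|U|)%N) (s01 : 0 <= s <= 1).

Let Hs := [set (finset.set0 : {set U})]%SET.
Let N : R := #|U|%:R.
Let N0 : 0 < N. Proof. by rewrite ltr0n. Qed.

Let corr (sigma sigma' : {ffun U -> bool}) : R :=
  \sum_u (-1) ^+ sigma u * (-1) ^+ sigma' u.

Let s2_le1 : s ^+ 2 <= 1.
Proof. by case/andP: s01 => ? ?; rewrite expr_le1. Qed.

Let corr_le sigma sigma' : `|s ^+ 2 / N * corr sigma sigma'| <= s ^+ 2.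
Proof.
rewrite normrM ger0_norm ?divr_ge0 ?sqr_ge0 ?(ltW N0) // mulrAC ler_pdivrMr //.
rewrite ler_wpM2l ?sqr_ge0 //; apply: (le_trans (ler_norm_sum _ _ _)).
rewrite -[leRHS](sumr_const predT 1); apply: ler_sum => u _.
by rewrite normrM !normr_sign mulr1.
Qed.

(** With the empty set as only heavy set the indices are uniform, and the sum over [v] is an
    expectation that factorises over the [m + m] positions. *)
Lemma uniform_replicasE sigma :
  \sum_v replica_sum (m := m) s 1 N^-1 Hs sigma v / evidence (m := m) 1 N^-1 Hs v =
  \sum_sigma' (1 + s ^+ 2 / N * corr sigma sigma') ^+ (m + m).
Proof.
have cI : #|{: 'I_m + 'I_m}| = (m + m)%N by rewrite card_sum card_ord.
have massE u : pair_mass 1 N^-1 finset.set0 u = N^-1 by rewrite /pair_mass inE.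
have sigE (tau : {ffun U -> bool}) u : signal R finset.set0 tau u = (-1) ^+ tau u.
  by rewrite /signal inE.
transitivity (\sum_(v : {ffun 'I_m + 'I_m -> U}) \sum_(sigma' : {ffun U -> bool})
  \prod_t (N^-1 * (1 + s ^+ 2 * ((-1) ^+ sigma (v t) * (-1) ^+ sigma' (v t))))).
  apply: eq_bigr => v _.
  rewrite /replica_sum /evidence !big_set1 /index_weight.
  under eq_bigr do rewrite massE.
  have Nn : \prod_(t : 'I_m + 'I_m) N^-1 != 0 by rewrite prodr_const expf_neq0 // invr_eq0 gt_eqF.
  rewrite mulrAC mulfK // mulr_sumr.
  apply: eq_bigr => sigma' _; rewrite big_split /=; congr (_ * _).
  by apply: eq_bigr => t _; rewrite !sigE.
rewrite exchange_big; apply: eq_bigr => sigma' _.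
rewrite -(bigA_distr_bigA (fun t u => N^-1 * (1 + s ^+ 2 * ((-1) ^+ sigma u * (-1) ^+ sigma' u)))).
rewrite prodr_const cI; congr (_ ^+ _).
rewrite -mulr_sumr big_split /= -mulr_sumr sumr_const mulrDr -/(corr _ _).
by rewrite mulrC -/N divff ?gt_eqF //; field; rewrite gt_eqF.
Qed.

(** The correlation of the sign vectors is replaced by its maximum, which is cheap for a single
    index, the case used below. *)
Lemma uniform_replicas_index sigma :
  \sum_v replica_sum (m := m) s 1 N^-1 Hs sigma v / evidence (m := m) 1 N^-1 Hs v <=
  expR ((m + m)%:R * s ^+ 2) * #|Hs|%:R * 2 ^+ #|U|.
Proof.
rewrite uniform_replicasE cards1 mulr1.
have -> : expR ((m + m)%:R * s ^+ 2) * 2 ^+ #|U| =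
    \sum_(sigma' : {ffun U -> bool}) expR (s ^+ 2) ^+ (m + m).
  by rewrite sumr_const card_ffun card_bool -[RHS]mulr_natr natrX expRM_natl.
apply: ler_sum => sigma' _.
move: (corr_le sigma sigma'); rewrite ler_norml => /andP[c1 c2].
apply: lerXn2r; rewrite ?nnegrE ?expR_ge0 //; first by have := s2_le1; lra.
by apply: le_trans (expR_ge1Dx _); lra.
Qed.

(** Here [sigma'] is averaged: after [1 + x <= expR x] the average factorises over the indices, and
    [expR_cosh_le] bounds each factor. *)
Lemma uniform_replicas_collision sigma :
  \sum_v replica_sum (m := m) s 1 N^-1 Hs sigma v / evidence (m := m) 1 N^-1 Hs v <=
  expR (2 * (m + m)%:R ^+ 2 * s ^+ 4 / N) * #|Hs|%:R * 2 ^+ #|U|.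
Proof.
rewrite uniform_replicasE cards1 mulr1.
pose a : R := (m + m)%:R * (s ^+ 2 / N).
have step sigma' : (1 + s ^+ 2 / N * corr sigma sigma') ^+ (m + m) <=
    \prod_u expR (a * ((-1) ^+ sigma u * (-1) ^+ sigma' u)).
  rewrite -expR_sum -mulr_sumr -/(corr _ _) /a -[X in expR X]mulrA expRM_natl.
  move: (corr_le sigma sigma'); rewrite ler_norml => /andP[c1 c2].
  by apply: lerXn2r; rewrite ?nnegrE ?expR_ge0 ?expR_ge1Dx //; have := s2_le1; lra.
apply: (@le_trans _ _ (\sum_(sigma' : {ffun U -> bool})
    \prod_u expR (a * ((-1) ^+ sigma u * (-1) ^+ sigma' u)))); first exact: ler_sum.
rewrite -(bigA_distr_bigA (fun u b => expR (a * ((-1) ^+ sigma u * (-1) ^+ (b : bool))))).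
have -> : expR (2 * (m + m)%:R ^+ 2 * s ^+ 4 / N) * 2 ^+ #|U| =
    \prod_(u : U) (2 * expR (2 * a ^+ 2)).
  rewrite big_split /= !prodr_const mulrC -expRM_natl -/N; congr (_ * expR _).
  by rewrite /a; field; rewrite gt_eqF.
apply: ler_prod => u _; rewrite big_bool /= addr_ge0 ?expR_ge0 //=.
case: (sigma u); rewrite !(expr0, expr1, mul1r, mulN1r, opprK, mulrN, mulr1).
  exact: expR_cosh_le.
by rewrite addrC expR_cosh_le.
Qed.
End UniformReplicas.

(** * Second moment with a random heavy set *)

Section SubsetReplicas.
Variables (R : realType) (m k : nat) (U : finType) (h l : R).
Hypotheses (h0 : 0 < h) (l0 : 0 < l) (mk : (m + m < k)%N).
Hypothesis (hl : 2 * (l / h) ^+ 2 <= 1).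

Let Hs := [set H : {set U} | #|H| == k]%SET.
Hypothesis mass1 : forall H, H \in Hs -> \sum_u pair_mass h l H u = 1.

Let I : finType := ('I_m + 'I_m)%type.
Let count (v : {ffun I -> U}) (u : U) : nat := #|[set t | v t == u]%SET|.

Let prod_count (v : {ffun I -> U}) (g : U -> R) :
  \prod_t g (v t) = \prod_u g u ^+ count v u.
Proof.
rewrite (partition_big v predT) //=; apply: eq_bigr => u _.
rewrite (eq_bigr (fun=> g u)) => [|t /eqP -> //].
by rewrite prodr_const; congr (_ ^+ _); apply: eq_card => t; rewrite !inE.
Qed.

Let sum_count (v : {ffun I -> U}) : (\sum_u count v u = m + m)%N.
Proof.
have -> : (m + m = \sum_(t : I) 1)%N by rewrite sum1_card card_sum card_ord.
rewrite (partition_big v predT) //=; apply: eq_bigr => u _.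
by rewrite sum1_card; apply: eq_card => t; rewrite !inE.
Qed.

Let seen_le (v : {ffun I -> U}) : (#|[set u | count v u != 0%N]%SET| <= m + m)%N.
Proof.
rewrite -(sum_count v) -sum1_card big_mkcond; apply: leq_sum => u _.
by rewrite inE -lt0n; case: ifP.
Qed.

(** At [s = 1], an index light in both replicas and seen [c] times contributes
    [(2 ^+ c + 0 ^+ c) / 2] on average over its sign. This bounds the excess over 1, which vanishes
    for [c <= 1]. *)
Let collision_weight (c : nat) : R := if (1 < c)%N then 2 ^+ c else 0.

Let collision_weight_ge0 c : 0 <= collision_weight c.
Proof. by rewrite /collision_weight; case: ifP. Qed.

(** Positions are regrouped by index; the signs of distinct indices then average independently. *)
Let signs_le (v : {ffun I -> U}) sigma H H' :
  \sum_sigma' \prod_t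
    (1 + 1 ^+ 2 * (signal R H sigma (v t) * signal R H' sigma' (v t))) <=
  2 ^+ #|U| * \prod_u (1 + (if (u \notin H) && (u \notin H')
                            then collision_weight (count v u) else 0)).
Proof.
pose g u (b : bool) : R :=
  1 + signal R H sigma u * (if u \in H' then 0 else (-1) ^+ b).
have -> : \sum_(sigma' : {ffun U -> bool}) \prod_t
    (1 + 1 ^+ 2 * (signal R H sigma (v t) * signal R H' sigma' (v t))) =
  \prod_u \sum_b g u b ^+ count v u.
  rewrite bigA_distr_bigA; apply: eq_bigr => sigma' _.
  rewrite (prod_count v (fun u => 1 + 1 ^+ 2 * (signal R H sigma u * signal R H' sigma' u))).
  by apply: eq_bigr => u _; rewrite expr1n mul1r.
rewrite -prodr_const -big_split /=; apply: ler_prod => u _.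
rewrite big_bool /g /signal.
have two c : 1 ^+ c + 1 ^+ c <= 2 * 1 :> R by rewrite !expr1n; lra.
have [uH|uH] /= := boolP (u \in H).
  by rewrite !mul0r !addr0 two andbT addr_ge0 // exprn_ge0.
have [uH'|uH'] /= := boolP (u \in H').
  by rewrite !mulr0 !addr0 two andbT addr_ge0 // exprn_ge0.
have pair c : 0 <= (2 : R) ^+ c + 0 ^+ c <= 2 * (1 + collision_weight c).
  rewrite addr_ge0 ?exprn_ge0 //= /collision_weight.
  case: c => [|[|c]] /=; rewrite ?expr0 ?expr1; try by lra.
  have : 0 <= (2 : R) ^+ c.+2 by rewrite exprn_ge0.
  by rewrite [0 ^+ _]exprS mul0r; lra.
have E2 : (1 + 1 : R) = 2 by [].
by case: (sigma u) => /=; rewrite !(expr0, expr1) ?mulrNN !(mulr1, mul1r, mulN1r) ?opprK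
  ?subrr ?E2 1?[0 ^+ _ + _]addrC pair.
Qed.

(** For each [v], [weight_replicas] applies with [q = m + m]. An index seen [c >= 2] times costs at
    most [(#|U| / (k - q)) ^+ 2 * (2 * (l / h) ^+ 2) ^+ c], where [hl] allows [c] to be lowered to
    2. *)
Lemma subset_replicas sigma :
  \sum_v replica_sum (m := m) 1 h l Hs sigma v / evidence (m := m) h l Hs v <=
  expR ((#|U|%:R / (k - (m + m))%:R) ^+ 2 * (2 * (l / h) ^+ 2) ^+ 2 * m%:R) *
    #|Hs|%:R * 2 ^+ #|U|.
Proof.
set E := expR _.
have weightE v H : index_weight h l H v = weight (count v) h l H :> R.
  by rewrite /index_weight (prod_count v (pair_mass h l H)).
have total : \sum_(v : {ffun I -> U}) evidence h l Hs v = #|Hs|%:R :> R.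
  rewrite exchange_big /= -sumr_const; apply: eq_bigr => H HHs.
  rewrite /index_weight -(bigA_distr_bigA (fun t : I => pair_mass h l H)).
  by rewrite prodr_const mass1 // expr1n.
have Hs_sum (F : {set U} -> R) : \sum_(H in Hs) F H = \sum_(H : {set U} | #|H| == k) F H.
  by apply: eq_bigl => H; rewrite inE.
rewrite -total mulrAC mulr_sumr; apply: ler_sum => v _.
have evE : evidence h l Hs v = \sum_(H : {set U} | #|H| == k) weight (count v) h l H.
  by rewrite /evidence Hs_sum; apply: eq_bigr => H _; rewrite weightE.
have ev0 : 0 <= evidence h l Hs v.
  by rewrite evE sumr_ge0 // => H _; exact/ltW/weight_gt0.
(* If there is no [k]-subset, the evidence is 0 and the quotient takes the default value 0. *)
have [ev1|ev1] := eqVneq (evidence h l Hs v) 0.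
  by rewrite ev1 invr0 !mulr0.
rewrite ler_pdivrMr ?lt_neqAle ?ev0 1?eq_sym ?ev1 //.
apply: (@le_trans _ _ (2 ^+ #|U| *
   (\sum_(H : {set U} | #|H| == k) \sum_(H' : {set U} | #|H'| == k)
    weight (count v) h l H * weight (count v) h l H' *
      \prod_u (1 + (if (u \notin H) && (u \notin H')
                    then collision_weight (count v u) else 0))))).
  rewrite /replica_sum Hs_sum mulr_sumr; apply: ler_sum => H _.
  rewrite Hs_sum mulr_sumr; apply: ler_sum => H' _.
  rewrite !weightE [leRHS]mulrCA ler_wpM2l ?mulr_ge0 ?(ltW (weight_gt0 _ _ _ _)) //.
  exact: signs_le.
have := @weight_replicas R U (count v) h l h0 l0 k (m + m)
  (fun u => collision_weight (count v u)) (seen_le v) mk (fun u => collision_weight_ge0 _).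
rewrite -evE => /(ler_wpM2l (exprn_ge0 #|U| (ler0n R 2))) /le_trans; apply.
have -> (e : R) : E * 2 ^+ #|U| * e * e = 2 ^+ #|U| * (e ^+ 2 * E) by ring.
rewrite ler_wpM2l ?exprn_ge0 // ler_wpM2l ?sqr_ge0 //.
(* Half the count is at least 1 for an index seen twice, and these halves sum to [m]. *)
have swap_le u : collision_weight (count v u) * swap_ratio (count v) h l k (m + m) u ^+ 2 <=
    (#|U|%:R / (k - (m + m))%:R) ^+ 2 * (2 * (l / h) ^+ 2) ^+ 2 * (2^-1 * (count v u)%:R).
  have A0 : 0 <= (#|U|%:R / (k - (m + m))%:R : R) ^+ 2 by exact: sqr_ge0.
  have r0 : 0 <= 2 * (l / h) ^+ 2 by rewrite mulr_ge0 ?sqr_ge0.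
  rewrite /collision_weight /swap_ratio; case: ifP => [c2|_]; last first.
    rewrite mul0r; apply: mulr_ge0; first by rewrite mulr_ge0 ?sqr_ge0.
    by rewrite mulr_ge0 ?invr_ge0 ?ler0n.
  set A := _ / _; rewrite exprMn mulrCA -mulrA ler_wpM2l //.
  rewrite -exprM mulnC exprM -exprMn.
  rewrite -[leLHS]mulr1; apply: ler_pM; rewrite ?exprn_ge0 //.
    by rewrite ler_wiXn2l.
  by rewrite ler_pdivlMl // mulr1 ler_nat.
apply: (@le_trans _ _ (\prod_u expR (collision_weight (count v u) *
    swap_ratio (count v) h l k (m + m) u ^+ 2))).
  apply: ler_prod => u _; rewrite expR_ge1Dx andbT addr_ge0 // mulr_ge0 ?sqr_ge0 //.
rewrite -expR_sum ler_expR; apply: (le_trans (ler_sum _ (fun u _ => swap_le u))).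
rewrite -mulr_sumr -mulr_sumr -natr_sum sum_count natrD.
have -> : 2^-1 * (m%:R + m%:R) = m%:R :> R by field.
exact: lexx.
Qed.
End SubsetReplicas.

(** * Lower bounds for tests with a fixed number of samples *)

Section LowerBounds.
Variables (R : realType) (n m : nat) (eps delta : R).
Variable B : pred {ffun 'I_m + 'I_m -> 'I_n}.
Hypotheses (n2 : (2 <= n)%N) (eps01 : 0 < eps < 1) (delta1 : 0 < delta < 1).
Hypothesis sepB : separates eps delta B.

Let uniform_family (U : finType) := [set (finset.set0 : {set U})]%SET.

(* No index is heavy, so the mass 1 of the heavy indices is a dummy. *)
Let uniform_bound (U : finType) (s K : R) : (0 < #|U|)%N -> (#|U| * 2 <= n)%N ->
  0 <= s <= 1 -> eps < s ->
  (forall sigma, \sum_v replica_sum (m := m) s 1 #|U|%:R^-1 (uniform_family U) sigma v /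
                        evidence (m := m) 1 #|U|%:R^-1 (uniform_family U) v
                 <= K * #|uniform_family U|%:R * 2 ^+ #|U|) ->
  (1 - delta) ^+ 2 <= delta * K.
Proof.
move=> U0 Un s01 es hK; have UR : #|U|%:R != 0 :> R by rewrite pnatr_eq0 -lt0n.
have d1 : delta < 1 by case/andP: delta1.
apply: (pair_test_bound s01 ltr01 _ Un _ d1 _ _ sepB hK).
- by rewrite invr_gt0 ltr0n.
- by rewrite cards1.
- move=> H; rewrite inE => /eqP ->.
  rewrite (eq_bigr (fun=> #|U|%:R^-1)) => [|u _]; last by rewrite /pair_mass inE.
  by rewrite sumr_const -[LHS]mulr_natr mulVf.
move=> H; rewrite inE => /eqP ->.
by rewrite finset.setC0 cardsT -[X in _ < X]mulr_natr mulfVK.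
Qed.

(** The distance of the uniform pair is [s]: it must exceed [eps] strictly, stay at most 1 and be of
    order [eps]. *)
Let s : R := Num.min 1 (2 * eps).

Let s_bounds : [/\ 0 <= s <= 1, eps < s & s <= 2 * eps].
Proof.
case/andP: eps01 => e0 e1; rewrite /s; split.
- by rewrite le_min ler01 ge_min lexx /= mulr_ge0 // ltW.
- by rewrite lt_min e1 /=; lra.
- by rewrite ge_min lexx orbT.
Qed.

(** One index, hence two symbols, suffices; 8 comes from [2m] samples and
    [s ^+ 2 <= 4 * eps ^+ 2]. *)
Lemma separates_index : (1 - delta) ^+ 2 <= delta * expR (8 * m%:R * eps ^+ 2).
Proof.
have [s01 es s2e] := s_bounds; have [d0 _] := andP delta1.
have U0 : (0 < #|'I_1|)%N by rewrite card_ord.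
have Un : (#|'I_1| * 2 <= n)%N by rewrite card_ord.
apply: le_trans (uniform_bound U0 Un s01 es (uniform_replicas_index m U0 s01)) _.
rewrite ler_pM2l // ler_expR natrD.
have : s ^+ 2 <= (2 * eps) ^+ 2.
  by case/andP: s01 => s0 _; case/andP: eps01 => e0 _; rewrite lerXn2r ?nnegrE // mulr_ge0 // ltW.
have : 0 <= m%:R :> R by [].
by rewrite exprMn; nra.
Qed.

(** There are [n./2] indices, and [384 = 2 * 4 * 16 * 3]: the exponent's 2, [(2m)^2],
    [s ^+ 4 <= 16 * eps ^+ 4] and [n <= 3 * n./2]. *)
Lemma separates_collision :
  (1 - delta) ^+ 2 <= delta * expR (384 * m%:R ^+ 2 * eps ^+ 4 / n%:R).
Proof.
have [s01 es s2e] := s_bounds; have [d0 _] := andP delta1.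
have N0 : (0 < n./2)%N by rewrite half_gt0.
have Nn : (n./2 * 2 <= n)%N by rewrite muln2 -[leqRHS](odd_double_half n) leq_addl.
have U0 : (0 < #|'I_(n./2)|)%N by rewrite card_ord.
have Un : (#|'I_(n./2)| * 2 <= n)%N by rewrite card_ord.
apply: le_trans (uniform_bound U0 Un s01 es (uniform_replicas_collision m U0 s01)) _.
rewrite card_ord ler_pM2l // ler_expR natrD.
have NR : 0 < (n./2)%:R :> R by rewrite ltr0n.
have nR : 0 < n%:R :> R by rewrite ltr0n (leq_trans _ n2).
have nN : n%:R <= 3 * (n./2)%:R :> R by rewrite -natrM ler_nat; move: n2; clear; lia.
have s4 : s ^+ 4 <= 16 * eps ^+ 4.
  have -> : 16 * eps ^+ 4 = (2 * eps) ^+ 4 by ring.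
  by case/andP: s01 => s0 _; case/andP: eps01 => e0 _; rewrite lerXn2r ?nnegrE // mulr_ge0 // ltW.
rewrite ler_pdivrMr // [leRHS]mulrAC ler_pdivlMr //.
have -> : 384 * m%:R ^+ 2 * eps ^+ 4 * (n./2)%:R =
  8 * m%:R ^+ 2 * ((16 * eps ^+ 4) * (3 * (n./2)%:R)) :> R by ring.
have -> : 2 * (m%:R + m%:R) ^+ 2 * s ^+ 4 * n%:R = 8 * m%:R ^+ 2 * (s ^+ 4 * n%:R) :> R by ring.
rewrite ler_wpM2l ?mulr_ge0 ?sqr_ge0 //.
by rewrite ler_pM // exprn_ge0 //; case/andP: s01.
Qed.

(** The [4 * m] heavy indices share mass [1 - beta] and the light ones [beta], which is the distance
    of the pair at [s = 1]. At least [2 * m] heavy indices remain unseen, and [r] bounds [l / h]. *)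
Lemma separates_subset (beta : R) :
  (0 < m)%N -> (8 * m <= n./2)%N -> eps < beta < 1 ->
  let r := 8 * beta * m%:R / ((1 - beta) * (n./2)%:R) in r <= 2^-1 ->
  (1 - delta) ^+ 2 <= delta * expR ((n./2)%:R ^+ 2 * r ^+ 4 / m%:R).
Proof.
move=> m0 mN /andP[eb b1] r r2; have [d0 d1] := andP delta1.
set N := n./2 in r r2 mN *; pose k := (4 * m)%N.
have Nn : (N * 2 <= n)%N by rewrite muln2 -[leqRHS](odd_double_half n) leq_addl.
have b0 : 0 < beta by apply: lt_trans eb; case/andP: eps01.
have kN : (k <= N)%N by rewrite /k; move: mN; clear; lia.
have mR : 0 < m%:R :> R by rewrite ltr0n.
have kE : k%:R = 4 * m%:R :> R by rewrite natrM.
have NkE : (N - k)%:R = N%:R - k%:R :> R by rewrite natrB.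
have mNR : 8 * m%:R <= N%:R :> R by rewrite -natrM ler_nat.
pose h : R := (1 - beta) / k%:R; pose l : R := beta / (N - k)%:R.
have h0 : 0 < h by rewrite divr_gt0 ?subr_gt0 // kE; lra.
have l0 : 0 < l by rewrite divr_gt0 // NkE kE; lra.
have a0 : 0 < 1 - beta by rewrite subr_gt0.
have NR : 0 < N%:R :> R by lra.
have lh0 : 0 <= l / h by rewrite divr_ge0 // ltW.
(* As [8 * m <= N], at least half of the indices are light; this turns the 4 of [k] into the 8 of
   [r]. *)
have lhr : l / h <= r.
  have -> : l / h = beta * (4 * m%:R) / ((1 - beta) * (N%:R - 4 * m%:R)).
    rewrite /l /h NkE kE; field.
    by rewrite !gt_eqF //; lra.
  rewrite /r ler_pdivrMr ?mulr_gt0 //; last by lra.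
  rewrite [leRHS]mulrAC ler_pdivlMr ?mulr_gt0 //.
  have -> : beta * (4 * m%:R) * ((1 - beta) * N%:R) =
    (4 * beta * m%:R * (1 - beta)) * N%:R by ring.
  have -> : 8 * beta * m%:R * ((1 - beta) * (N%:R - 4 * m%:R)) =
    (4 * beta * m%:R * (1 - beta)) * (2 * (N%:R - 4 * m%:R)) by ring.
  by rewrite ler_wpM2l ?mulr_ge0 // ?(ltW b0) ?(ltW a0) //; lra.
have mass1 H : H \in [set H : {set 'I_N} | #|H| == k]%SET -> \sum_u pair_mass h l H u = 1.
  rewrite inE => /eqP Hk; rewrite (bigID (mem H)) /=.
  rewrite (eq_bigr (fun=> h)) => [|u uH]; last by rewrite /pair_mass uH.
  rewrite [X in _ + X](eq_bigr (fun=> l)) => [|u /negbTE uH]; last by rewrite /pair_mass uH.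
  rewrite !sumr_const Hk -[h *+ _]mulr_natr -[l *+ _]mulr_natr /h /l.
  have -> : #|[predC H]| = (N - k)%N.
    by rewrite -Hk -[X in (X - _)%N](card_ord N) -(cardC (mem H)) addKn.
  rewrite !mulfVK ?gt_eqF // ?NkE ?kE; lra.
have mk : (m + m < k)%N by rewrite /k; move: m0; clear; lia.
have hl : 2 * (l / h) ^+ 2 <= 1.
  have : (l / h) ^+ 2 <= 2^-1 ^+ 2 by rewrite lerXn2r ?nnegrE ?invr_ge0 // (le_trans lhr).
  by lra.
have cU : (#|'I_N| * 2 <= n)%N by rewrite card_ord.
have Hs0 : (0 < #|[set H : {set 'I_N} | #|H| == k]%SET|)%N.
  by rewrite card_draws card_ord bin_gt0.
have := pair_test_bound (s := 1) _ h0 l0 cU Hs0 d1 mass1 _ sepB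
  (subset_replicas h0 l0 mk hl mass1).
rewrite ler01 lexx => /(_ isT).
have far H : H \in [set H : {set 'I_N} | #|H| == k]%SET -> eps < 1 * l *+ #|~: H|.
  rewrite inE => /eqP Hk; rewrite mul1r cardsCs finset.setCK Hk card_ord.
  by rewrite -[X in _ < X]mulr_natr mulfVK // gt_eqF // NkE kE; lra.
move=> /(_ far) /le_trans; apply.
rewrite ler_pM2l // ler_expR card_ord.
have -> : (k - (m + m))%:R = 2 * m%:R :> R by rewrite -natrM /k; congr _%:R; clear; lia.
have -> : (N%:R / (2 * m%:R)) ^+ 2 * (2 * (l / h) ^+ 2) ^+ 2 * m%:R =
   N%:R ^+ 2 / m%:R * (l / h) ^+ 4 :> R.
  by move: (l / h) => x; field; rewrite gt_eqF.
rewrite [leRHS]mulrAC ler_wpM2l ?divr_ge0 ?sqr_ge0 //.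
by rewrite lerXn2r ?nnegrE // (le_trans lh0).
Qed.
End LowerBounds.

(** * From stopping rules to tests *)

Local Open Scope classical_set_scope.

Definition obs_index (m : nat) (t : 'I_m + 'I_m) : nat + nat :=
  match t with inl i => inl (val i) | inr i => inr (val i) end.

Lemma obs_index_inj m : injective (@obs_index m).
Proof. by case=> i [] j //= [] /val_inj ->. Qed.

Definition prefix_obs (R : realType) (n m : nat) (D1 D2 : distr R n)
    (S : iid_samples D1 D2) (w : Omega S) : {ffun 'I_m + 'I_m -> 'I_n} :=
  [ffun t => obs (obs_index t) w].

Section Law.
Variables (R : realType) (n m : nat) (D1 D2 : distr R n) (S : iid_samples D1 D2).

Lemma prefix_obs_fiber (z : {ffun 'I_m + 'I_m -> 'I_n}) :
  measurable [set w : Omega S | prefix_obs m w = z] /\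
  Pr S [set w : Omega S | prefix_obs m w = z] =
    (\prod_t side D1 D2 t (z t))%:E.
Proof.
have fiberE : [set w : Omega S | prefix_obs m w = z] =
    \bigcap_(t in [set: 'I_m + 'I_m]) (obs (obs_index t) @^-1` [set z t]).
  apply/seteqP; split => w /=.
    by move=> <- t _ /=; rewrite ffunE.
  by move=> wz; apply/ffunP => t; rewrite ffunE; exact: wz.
split.
  rewrite fiberE; apply: fin_bigcap_measurable => // t _; exact: obs_measurable.
pose J := map (@obs_index m) (enum ([the finType of ('I_m + 'I_m)%type])).
(* [obs_indep] wants a set at every index: this one is [[set z t]] at [obs_index t] and everything
   outside the prefix. *)
pose A s := [set a | forall t, obs_index t = s -> a = z t].
have AE t : A (obs_index t) = [set z t].
  apply/seteqP; split => a /=; first by move=> /(_ t erefl).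
  by move=> -> t' /obs_index_inj ->.
have -> : [set w : Omega S | prefix_obs m w = z] =
    [set w | forall i, i \in J -> A i (obs i w)].
  rewrite fiberE; apply/seteqP; split => w /= wz.
    move=> i /mapP[t _ ->]; rewrite AE; exact: wz.
  by move=> t _ /=; rewrite -[_ = z t]/([set z t] _) -AE; apply: wz; rewrite map_f ?mem_enum.
rewrite (obs_indep S); last by rewrite map_inj_uniq ?enum_uniq //; exact: obs_index_inj.
rewrite big_map -prodEFin big_enum /=; apply: eq_bigr => t _; rewrite AE.
by case: t => i; [exact: obs_lawx|exact: obs_lawy].
Qed.

Lemma prefix_obs_law (E : pred {ffun 'I_m + 'I_m -> 'I_n}) :
  measurable [set w : Omega S | E (prefix_obs m w)] /\
  Pr S [set w : Omega S | E (prefix_obs m w)] =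
    (\sum_(z | E z) \prod_t side D1 D2 t (z t))%:E.
Proof.
have -> : [set w : Omega S | E (prefix_obs m w)] =
  \bigcup_(z in [set z | E z]) [set w : Omega S | prefix_obs m w = z].
  apply/seteqP; split => w /=; first by move=> Ew; exists (prefix_obs m w).
  by case=> z /= Ez ->.
have mf z : measurable [set w : Omega S | prefix_obs m w = z].
  by have [] := prefix_obs_fiber z.
split; first by apply: fin_bigcup_measurable.
rewrite measure_fin_bigcup //; last first.
- by move=> z1 z2 _ _ [w /= [<- <-]].
- exact: finite_finset.
transitivity (\sum_(z \in [set z | E z]) (\prod_t side D1 D2 t (z t))%:E)%E.
  by apply: eq_fsbigr => z _; exact: (prefix_obs_fiber z).2.
rewrite -sumEFin [RHS]bigfs ?index_enum_uniq // => z _.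
by rewrite mem_index_enum.
Qed.
End Law.

Section Stopping.
Variables (R : realType) (n : nat) (T : stopping_rule n).

Definition decides (j m : nat) (z : {ffun 'I_m + 'I_m -> 'I_n}) : bool :=
  T m [tuple z (inl i) | i < m] [tuple z (inr i) | i < m] == j :> nat.

Lemma decision_mono (x y : nat -> 'I_n) (s t j : nat) : (s <= t)%N -> (0 < j)%N ->
  T s [tuple x (val i) | i < s] [tuple y (val i) | i < s] = j :> nat ->
  T t [tuple x (val i) | i < t] [tuple y (val i) | i < t] = j :> nat.
Proof.
move=> /subnKC <- j0 Tj; move: (t - s)%N => l {t}.
have catE (f : nat -> 'I_n) : [tuple f (val i) | i < s + l] =
    cat_tuple [tuple f (val i) | i < s] [tuple f (s + val i)%N | i < l].
  apply: eq_from_tnth => i; rewrite tnth_mktuple.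
  by case: (split_ordP i) => k ->; rewrite ?tnth_lshift ?tnth_rshift tnth_mktuple.
by rewrite !catE decision_stable Tj //; apply/eqP; rewrite -lt0n.
Qed.

Variables (D1 D2 : distr R n) (S : iid_samples D1 D2).

Let says (t j : nat) (w : Omega S) : Prop :=
  T t [tuple obs (inl (val i)) w | i < t] [tuple obs (inr (val i)) w | i < t] = j :> nat.

Let says_mono w (s t j : nat) : (s <= t)%N -> (0 < j)%N -> says s j w -> says t j w.
Proof.
move=> st j0.
exact: (decision_mono (x := fun i => obs (inl i) w) (y := fun i => obs (inr i) w) st j0).
Qed.

Let says_inj w s t j k : (0 < j)%N -> (0 < k)%N -> says s j w -> says t k w -> j = k.
Proof.
move=> j0 k0 sj tk.
have [st|/ltnW ts] := leqP s t.
  by rewrite -(says_mono st j0 sj).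
by rewrite -(says_mono ts k0 tk).
Qed.

Let tau_le w t j : says t j w -> (tau j T w <= (t%:R)%:E)%E.
Proof. by move=> h; apply: ereal_inf_lbound; exists t. Qed.

Let tau_lt w j (x : \bar R) : (tau j T w < x)%E -> exists2 t, says t j w & ((t%:R)%:E < x)%E.
Proof. by case/ereal_inf_lt => _ [t h <-] hx; exists t. Qed.

Let decides_prefix j m w : decides j (prefix_obs m w) = (says m j w) :> Prop.
Proof.
apply/propext; rewrite /decides /says.
rewrite (_ : [tuple _ | i < m] = [tuple obs (inl (val i)) w | i < m]); last first.
  by apply: eq_mktuple => i; rewrite ffunE.
rewrite (_ : [tuple prefix_obs m w (inr i) | i < m] =
             [tuple obs (inr (val i)) w | i < m]); last first.
  by apply: eq_mktuple => i; rewrite ffunE.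
by split=> [/eqP|/eqP].
Qed.

(** By stability, an answer 1 given by time [b] is still given at the last integer time before
    [b]. *)
Lemma tau1_le_truncn (b : R) : 0 <= b ->
  [set w : Omega S | (tau 1 T w <= b%:E)%E] =
  [set w | decides 1 (prefix_obs (Num.truncn b) w)].
Proof.
move=> b0; apply/seteqP; split => w /=; rewrite decides_prefix.
  (* A strict bound on the infimum yields an actual time below [truncn b + 1]. *)
  move=> tb; have : (tau 1 T w < ((Num.truncn b).+1%:R)%:E)%E.
    by apply: le_lt_trans tb _; rewrite lte_fin truncnS_gt.
  case/tau_lt => t ht; rewrite lte_fin ltr_nat ltnS => tb'.
  exact: says_mono ht.
move=> /tau_le /le_trans; apply; by rewrite lee_fin truncn_le.
Qed.

Lemma tau1_le_neg (b : R) : b < 0 -> [set w : Omega S | (tau 1 T w <= b%:E)%E] = set0.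
Proof.
move=> b0; apply/seteqP; split => w //= tb.
have /tau_lt[t _] : (tau 1 T w < 0)%E by apply: le_lt_trans tb _; rewrite lte_fin.
by rewrite lte_fin ltNge ler0n.
Qed.

(** Once 2 is answered, 1 is never answered, so [tau 1] is infinite. *)
Let tau2_lt_tau1 w : (tau 2 T w < tau 1 T w)%E <-> exists t, says t 2 w.
Proof.
split; first by case/tau_lt => t ht _; exists t.
case=> t ht; apply: (@le_lt_trans _ _ (t%:R)%:E); first exact: tau_le.
have -> : tau 1 T w = +oo%E; last exact: ltry.
apply/eqP; rewrite -leye_eq leNgt; apply/negP => /tau_lt[s hs _].
by have := says_inj (ltn0Sn 1) (ltn0Sn 0) ht hs.
Qed.

Let measurable_says t j : measurable [set w | says t j w].
Proof.
have := (prefix_obs_law S (@decides j t)).1.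
by congr measurable; apply/seteqP; split => w /=; rewrite decides_prefix.
Qed.

Lemma decides_le_tau (m : nat) :
  (Pr S [set w | decides 1 (prefix_obs m w)] <= Pr S [set w | tau 1 T w <= tau 2 T w])%E.
Proof.
apply: le_measure; rewrite ?inE.
- exact: (prefix_obs_law S _).1.
(* The complement is a countable union of events on finite prefixes; paths that never stop belong to
   the event, both times being infinite. *)
- have -> : [set w : Omega S | (tau 1 T w <= tau 2 T w)%E] = ~` \bigcup_t [set w | says t 2 w].
    apply/seteqP; split => w /=; rewrite leNgt.
      by move=> /negP h [t _ ht]; apply: h; apply/tau2_lt_tau1; exists t.
    by move=> h; apply/negP => /tau2_lt_tau1[t ht]; apply: h; exists t.
  by apply: measurableC; apply: bigcupT_measurable => t; exact: measurable_says.
move=> w /=; rewrite decides_prefix leNgt => h1; apply/negP => /tau2_lt_tau1[t h2].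
by have := says_inj (ltn0Sn 0) (ltn0Sn 1) h1 h2.
Qed.
End Stopping.

Section FromStoppingRule.
Variables (R : realType) (n : nat).

Lemma sum_prod_side (m : nat) (D1 D2 : distr R n) :
  \sum_(z : {ffun 'I_m + 'I_m -> 'I_n}) \prod_t side D1 D2 t (z t) = 1.
Proof.
rewrite -(bigA_distr_bigA (fun t i => side D1 D2 t i)) big1 // => -[] i _; exact: mass_sum1.
Qed.

(** Two point masses at distinct symbols are at distance 1. *)
Lemma exists_far_pair (eps : R) : (2 <= n)%N -> eps < 1 ->
  exists D1 D2 : distr R n, eps < TV D1 D2.
Proof.
move=> n2 e1.
have d0 (i a : 'I_2) : 0 <= (a == i)%:R :> R by [].
have d1 (i : 'I_2) : \sum_a (a == i)%:R = 1 :> R.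
  by rewrite -natr_sum -[RHS]/(1%:R); congr _%:R; rewrite -big_mkcond big_pred1_eq.
have inj : injective (widen_ord n2) by move=> a b /(congr1 val) /= /val_inj.
exists (pushforward_distr (widen_ord n2) (d0 ord0) (d1 ord0)).
exists (pushforward_distr (widen_ord n2) (d0 ord_max) (d1 ord_max)).
rewrite TV_pushforward // !big_ord_recl big_ord0 /= subr0 sub0r normrN normr1 addr0.
by have -> : 2^-1 * (1 + 1) = 1 :> R by field.
Qed.

Variables (eps delta : R) (S : sampling R n) (T : stopping_rule n) (bound : R -> R).
Hypotheses (n2 : (2 <= n)%N) (eps1 : eps < 1) (delta1 : delta < 1).
Hypotheses (T_correct : delta_correct S eps delta T) (T_stops : stops_within S eps delta T bound).

(** A sample on which [T] is still undecided at time [m] also counts as rejected. *)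
Let rejects m (z : {ffun 'I_m + 'I_m -> 'I_n}) := ~~ decides T 1 z.

Lemma bound_ge0 : 0 <= bound eps.
Proof.
have [D _] := exists_far_pair n2 eps1; rewrite leNgt; apply/negP => b0.
have := T_stops.2 D; rewrite (tau1_le_neg _ _ b0) measure0 lee_fin subr_le0.
by rewrite leNgt delta1.
Qed.

Lemma rule_separates : separates eps delta (@rejects (Num.truncn (bound eps))).
Proof.
have total (D1 D2 : distr R n) := sum_prod_side (Num.truncn (bound eps)) D1 D2.
split=> [D|D1 D2 far].
  have := T_stops.2 D; rewrite (tau1_le_truncn _ _ bound_ge0) (prefix_obs_law _ _).2 lee_fin.
  have := total D D; rewrite (bigID (@decides n T 1 _)) /= => h1 h2.
  have -> : \sum_(z | @rejects (Num.truncn (bound eps)) z) \prod_t D (z t) =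
      \sum_(z | ~~ @decides n T 1 (Num.truncn (bound eps)) z)
        \prod_t side D D t (z t).
    by apply: eq_bigr => z _; apply: eq_bigr => -[].
  lra.
have := T_correct.2 D1 D2 far.
move=> /(le_trans (decides_le_tau T (S D1 D2) (Num.truncn (bound eps)))).
rewrite (prefix_obs_law _ _).2 lee_fin.
have := total D1 D2; rewrite (bigID (@decides n T 1 _)) /= => h.
rewrite /rejects; lra.
Qed.

(** Without samples there is a single outcome, of probability 1 under equal and far pairs alike, so
    no test separates them. This later forces the logarithm in each budget to be positive. *)
Lemma bound_ge1 : 1 <= bound eps.
Proof.
rewrite leNgt; apply/negP => b1.
have m0 : Num.truncn (bound eps) = 0%N.
  by apply/eqP; rewrite -leqn0 -ltnS -(ltr_nat R) (le_lt_trans _ b1) // truncn_le bound_ge0.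
have := rule_separates; rewrite m0 => -[sep0 sep1].
have [D1 [D2 far]] := exists_far_pair n2 eps1.
have one (F : 'I_0 + 'I_0 -> R) : \prod_t F t = 1 by rewrite big1 // => -[[]|[]].
have := sep1 _ _ far; have := sep0 D1.
under eq_bigr do rewrite one; under [in X in _ -> X -> _]eq_bigr do rewrite one.
rewrite sumr_const => c1 c2.
have : (#|@rejects 0|%:R : R) < 1%:R by apply: le_lt_trans c1 delta1.
rewrite ltr_nat ltnS leqn0 => /eqP c0; move: c2; rewrite c0.
by rewrite mulr0n subr_le0 leNgt delta1.
Qed.
End FromStoppingRule.

(** * Sample budgets *)

(** A positive logarithm means [delta < 1/3], so the left side exceeds 4/9 while the right side is
    at most 1/3. *)
Lemma second_moment_too_small (R : realType) (delta X : R) : 0 < delta < 1 ->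
  0 < ln (1 / (3 * delta)) -> X <= ln (1 / (3 * delta)) ->
  ~ (1 - delta) ^+ 2 <= delta * expR X.
Proof.
move=> /andP[d0 d1] L0 XL h.
have q0 : 0 < 1 / (3 * delta) by rewrite divr_gt0 // mulr_gt0.
have d3 : 3 * delta < 1.
  rewrite ltNge; apply/negP => d3; move: L0; rewrite ltNge ln_le0 //.
  by rewrite ler_pdivrMr ?mulr_gt0 // mul1r.
have : delta * expR X <= 1 / 3.
  have -> : 1 / 3 = delta * (1 / (3 * delta)) by field; rewrite gt_eqF.
  by rewrite ler_pM2l // -[leRHS]lnK ?posrE // ler_expR.
by move: h; rewrite expr2; nra.
Qed.

(** The constant 20 is chosen so that [384 <= 20 ^ 2]. For [L <= 0] the square root is 0 and the
    budget could not reach 1. *)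
Lemma collision_budget (R : realType) (n m : nat) (eps L : R) : (0 < n)%N -> 0 < eps ->
  1 <= 20^-1 * (Num.sqrt (n%:R * L) / eps ^+ 2) ->
  m%:R <= 20^-1 * (Num.sqrt (n%:R * L) / eps ^+ 2) ->
  0 < L /\ 384 * m%:R ^+ 2 * eps ^+ 4 / n%:R <= L.
Proof.
move=> n0 e0 b1 mb; have nR : 0 < n%:R :> R by rewrite ltr0n.
have L0 : 0 < L.
  rewrite ltNge; apply/negP => L0; move: b1.
  by rewrite ler0_sqrtr ?mulr_ge0_le0 // mul0r mulr0 ler10.
split=> //; rewrite ler_pdivrMr //.
have h : m%:R * eps ^+ 2 <= 20^-1 * Num.sqrt (n%:R * L).
  by move: mb; rewrite mulrA ler_pdivlMr // exprn_gt0.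
have : (m%:R * eps ^+ 2) ^+ 2 <= (20^-1 * Num.sqrt (n%:R * L)) ^+ 2.
  by rewrite lerXn2r ?nnegrE ?mulr_ge0 ?sqrtr_ge0 ?invr_ge0 ?ler0n ?(ltW e0).
rewrite exprMn [in leRHS]exprMn sqr_sqrtr ?mulr_ge0 ?(ltW L0) // -exprM.
have : 0 < n%:R * L by rewrite mulr_gt0.
rewrite exprVn; nra.
Qed.

Lemma powR_cube (R : realType) (x p : R) (k : nat) : 0 <= x -> p * 3 = k%:R ->
  (x `^ p) ^+ 3 = x ^+ k.
Proof. by move=> x0 pk; rewrite -powR_mulrn ?powR_ge0 // -powRrM pk powR_mulrn. Qed.

(** Cubing removes the fractional exponents; [L] is positive because [cbrt] keeps the sign of its
    argument. *)
Lemma cbrt_bound_cube (R : realType) (n m : nat) (eps L c : R) : 0 < eps -> 0 < c ->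
  1 <= c * (n%:R `^ (2 / 3) * cbrt L / eps `^ (4 / 3)) ->
  m%:R <= c * (n%:R `^ (2 / 3) * cbrt L / eps `^ (4 / 3)) ->
  0 < L /\ m%:R ^+ 3 * eps ^+ 4 <= c ^+ 3 * n%:R ^+ 2 * L.
Proof.
move=> e0 c0 b1 mb.
have ep : 0 < eps `^ (4 / 3) by exact: powR_gt0.
have L0 : 0 < L.
  rewrite ltNge; apply/negP => L0; move: b1; rewrite leNgt => /negP; apply.
  apply: le_lt_trans ltr01; rewrite pmulr_rle0 // pmulr_lle0 ?invr_gt0 //.
  rewrite mulr_ge0_le0 ?powR_ge0 // /cbrt mulr_le0_ge0 ?powR_ge0 //.
  by rewrite sgr_le0.
split=> //; have cbrtE : cbrt L = L `^ 3^-1 by rewrite /cbrt gtr0_sg // mul1r gtr0_norm.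
have h : m%:R * eps `^ (4 / 3) <= c * (n%:R `^ (2 / 3) * L `^ 3^-1).
  by move: mb; rewrite cbrtE mulrA ler_pdivlMr.
have : (m%:R * eps `^ (4 / 3)) ^+ 3 <= (c * (n%:R `^ (2 / 3) * L `^ 3^-1)) ^+ 3.
  by rewrite lerXn2r ?nnegrE ?mulr_ge0 ?powR_ge0 // ltW.
rewrite !exprMn (@powR_cube _ eps _ 4) ?(ltW e0) //; last by field.
rewrite (@powR_cube _ n%:R _ 2) //; last by field.
rewrite (@powR_cube _ L _ 1) ?(ltW L0) //; last by field.
by rewrite expr1 mulrA.
Qed.

(** For large [L] the collision bound applies; for small [L] the budget makes [m] a small fraction
    of [n], as the random heavy set requires. *)
Lemma mixed_budget (R : realType) (n m : nat) (eps eps0 L delta : R)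
    (B : pred {ffun 'I_m + 'I_m -> 'I_n}) :
  let a := eps0 * ((1 - eps0) / 2) in let c := (a / 32) ^+ 2 in
  (2 <= n)%N -> (0 < m)%N -> 0 < eps0 < 1 -> 0 < eps <= eps0 -> 0 < delta < 1 -> 0 < L ->
  m%:R ^+ 3 * eps ^+ 4 <= c ^+ 3 * n%:R ^+ 2 * L ->
  separates eps delta B ->
  exists2 X, X <= L & (1 - delta) ^+ 2 <= delta * expR X.
Proof.
move=> a c n2 m0 /andP[e00 e01] /andP[ep ee0] d01 L0 mL sep.
have e1 : 0 < eps < 1 by rewrite ep (le_lt_trans ee0).
have nR : 0 < n%:R :> R by rewrite ltr0n (leq_trans _ n2).
have mR : 0 < m%:R :> R by rewrite ltr0n.
have a0 : 0 < a by rewrite mulr_gt0 // divr_gt0 // subr_gt0.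
have a2e : a <= (1 - eps0) / 2 by rewrite /a ler_piMl ?divr_ge0 ?(ltW e01) // ?subr_ge0 ltW.
have a1 : a < 1 by apply: le_lt_trans a2e _; lra.
have c0 : 0 < c by rewrite exprn_gt0 // divr_gt0 // ltr0n.
have a2a : a ^+ 2 <= a by rewrite expr2 ler_piMl // ltW.
have ca : c <= a * 1000^-1 by rewrite /c expr2; move: a2a; rewrite expr2; lra.
have c1 : c <= 1000^-1 by lra.
have c2 : c ^+ 2 <= c * 1000^-1 by rewrite expr2 ler_wpM2l // ltW.
have c3 : c ^+ 3 <= c ^+ 2 * 1000^-1 by rewrite exprSr ler_wpM2l // sqr_ge0.
(* [q] is the constant of [separates_collision]. *)
have [q qE] : exists q : R, q = 384 by exists 384.
have q0 : 0 < q by rewrite qE ltr0n.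
have pos3 : 0 <= m%:R ^+ 3 * eps ^+ 4 by rewrite mulr_ge0 // exprn_ge0 // ltW.
(* At the threshold, the bound [q^3 c^6 n^4 eps^4 L^2] on the cube of [q m^2 eps^4] equals
   [(L n)^3]. *)
have [Lbig|Lsmall] := leP (q ^+ 3 * c ^+ 6 * n%:R * eps ^+ 4) L.
  exists (q * m%:R ^+ 2 * eps ^+ 4 / n%:R).
    have qe0 : 0 <= q ^+ 3 * eps ^+ 4 by rewrite mulr_ge0 // exprn_ge0 // ltW.
    have lhs0 : 0 <= q * m%:R ^+ 2 * eps ^+ 4.
      by apply: mulr_ge0; [apply: mulr_ge0; rewrite ?sqr_ge0 // ltW|rewrite exprn_ge0 // ltW].
    have Ln0 : 0 <= L * n%:R by rewrite mulr_ge0 // ltW.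
    rewrite ler_pdivrMr // -(@ler_pXn2r _ 3) ?nnegrE //.
    have -> : (q * m%:R ^+ 2 * eps ^+ 4) ^+ 3 =
        q ^+ 3 * eps ^+ 4 * (m%:R ^+ 3 * eps ^+ 4) ^+ 2 by ring.
    apply: (@le_trans _ _ (q ^+ 3 * eps ^+ 4 * (c ^+ 3 * n%:R ^+ 2 * L) ^+ 2)).
      by rewrite ler_wpM2l // lerXn2r ?nnegrE // (le_trans pos3).
    have -> : q ^+ 3 * eps ^+ 4 * (c ^+ 3 * n%:R ^+ 2 * L) ^+ 2 =
        (q ^+ 3 * c ^+ 6 * n%:R * eps ^+ 4) * (n%:R ^+ 3 * L ^+ 2) by ring.
    have -> : (L * n%:R) ^+ 3 = L * (n%:R ^+ 3 * L ^+ 2) by ring.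
    by rewrite ler_wpM2r // mulr_ge0 ?sqr_ge0 // exprn_ge0.
  by rewrite qE; exact: separates_collision n2 e1 d01 sep.
have mn : m%:R <= q * c ^+ 3 * n%:R.
  have rhs0 : 0 <= q * c ^+ 3 * n%:R.
    by apply: mulr_ge0 => //; apply: mulr_ge0 (ltW q0) (exprn_ge0 3 (ltW c0)).
  rewrite -(@ler_pXn2r _ 3) ?nnegrE //.
  rewrite -(ler_pM2r (exprn_gt0 4 ep)); apply: (le_trans mL).
  apply: (@le_trans _ _ (c ^+ 3 * n%:R ^+ 2 * (q ^+ 3 * c ^+ 6 * n%:R * eps ^+ 4))).
    by rewrite ler_wpM2l ?(ltW Lsmall) // mulr_ge0 ?sqr_ge0 // exprn_ge0 // ltW.
  by rewrite le_eqVlt; apply/orP; left; apply/eqP; ring.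
have N3 : n%:R <= 3 * (n./2)%:R :> R by rewrite -natrM ler_nat; move: n2; clear; lia.
have NR : 0 < (n./2)%:R :> R by rewrite ltr0n half_gt0.
have an0 : 0 < a * n%:R by rewrite mulr_gt0.
have mn' : 100 * m%:R <= a * n%:R.
  have qc : q * c ^+ 3 * n%:R <= 1000^-1 * (a * n%:R).
    by rewrite [leRHS]mulrA ler_wpM2r // qE; lra.
  have := le_trans mn qc; move: an0; set x := a * n%:R; lra.
clear Lsmall mn qE.
have mN : (8 * m <= n./2)%N.
  rewrite -(ler_nat R) natrM; have : a * n%:R <= n%:R by rewrite ler_piMl // ltW.
  lra.
(* Scaling [eps] so that [eps0] goes to the midpoint of [eps0] and 1 keeps [beta] above [eps] and
   away from 1. *)
pose beta := eps * ((1 + eps0) / (2 * eps0)).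
have beta_eps0 : beta <= (1 + eps0) / 2.
  have -> : (1 + eps0) / 2 = eps0 * ((1 + eps0) / (2 * eps0)) by field; rewrite gt_eqF.
  by rewrite ler_wpM2r // divr_ge0 ?mulr_ge0 ?addr_ge0 // ltW.
have eb : eps < beta < 1.
  apply/andP; split; last by apply: le_lt_trans beta_eps0 _; lra.
  by rewrite ltr_pMr // ltr_pdivlMr ?mulr_gt0 //; lra.
have b0 : 0 < beta by case/andP: eb => eb _; apply: lt_trans eb.
have beta_le : beta <= eps / eps0.
  rewrite /beta ler_pM2l // ler_pdivrMr ?mulr_gt0 //.
  by rewrite mulrCA mulVf ?gt_eqF // mulr1; lra.
have b1 : (1 - eps0) / 2 <= 1 - beta by lra.
clearbody beta.
pose r := 8 * beta * m%:R / ((1 - beta) * (n./2)%:R).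
have b1' : 0 < 1 - beta by case/andP: eb => _ ?; rewrite subr_gt0.
(* 24 is 8 times the 3 of [N3]; the two factors of [a] come from [beta <= eps / eps0] and from
   [b1]. *)
have r_le : r <= 24 * eps * m%:R / (a * n%:R).
  rewrite /r ler_pdivrMr ?mulr_gt0 // [leRHS]mulrAC ler_pdivlMr //.
  have -> : 8 * beta * m%:R * (a * n%:R) = 8 * m%:R * (beta * eps0 * ((1 - eps0) / 2) * n%:R).
    by rewrite /a; ring.
  have -> : 24 * eps * m%:R * ((1 - beta) * (n./2)%:R) =
     8 * m%:R * (eps * (1 - beta) * (3 * (n./2)%:R)) by ring.
  have half0 : 0 <= (1 - eps0) / 2 by rewrite divr_ge0 // subr_ge0 ltW.
  have be0 := mulr_ge0 (ltW b0) (ltW e00).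
  rewrite ler_wpM2l ?mulr_ge0 // ler_pM // ?(mulr_ge0 be0 half0) //.
  by rewrite ler_pM // -ler_pdivlMr.
have r0 : 0 <= r by rewrite divr_ge0 ?mulr_ge0 ?(ltW b0) ?(ltW b1').
have r2 : r <= 2^-1.
  apply: (le_trans r_le); rewrite ler_pdivrMr //.
  have : eps * m%:R <= m%:R by rewrite ler_piMl //; case/andP: e1 => _ /ltW.
  by rewrite -mulrA; lra.
exists ((n./2)%:R ^+ 2 * r ^+ 4 / m%:R); last exact: separates_subset e1 d01 sep _ m0 mN eb r2.
rewrite ler_pdivrMr //.
have Nn : (n./2)%:R <= n%:R :> R by rewrite ler_nat; move: n2; clear; lia.
apply: (@le_trans _ _ (n%:R ^+ 2 * (24 * eps * m%:R / (a * n%:R)) ^+ 4)).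
  rewrite ler_pM ?sqr_ge0 ?exprn_ge0 //.
    by rewrite lerXn2r ?nnegrE // ltW.
  by rewrite lerXn2r ?nnegrE // (le_trans r0).
have [p pE] : exists p : R, p = 24 by exists 24.
have p0 : 0 <= p by rewrite pE ler0n.
rewrite -pE.
have -> : n%:R ^+ 2 * (p * eps * m%:R / (a * n%:R)) ^+ 4 =
    p ^+ 4 * m%:R * (m%:R ^+ 3 * eps ^+ 4) / (a ^+ 4 * n%:R ^+ 2).
  by field; rewrite !gt_eqF.
have p4 : 0 <= p ^+ 4 by rewrite exprn_ge0.
rewrite ler_pdivrMr; last by rewrite mulr_gt0 // exprn_gt0.
apply: (@le_trans _ _ (p ^+ 4 * m%:R * (c ^+ 3 * n%:R ^+ 2 * L))).
  by rewrite ler_wpM2l // mulr_ge0.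
have -> : p ^+ 4 * m%:R * (c ^+ 3 * n%:R ^+ 2 * L) =
   (p ^+ 4 * c ^+ 3) * (m%:R * n%:R ^+ 2 * L) by ring.
have -> : L * m%:R * (a ^+ 4 * n%:R ^+ 2) = a ^+ 4 * (m%:R * n%:R ^+ 2 * L) by ring.
have mnL : 0 <= m%:R * n%:R ^+ 2 * L by rewrite mulr_ge0 ?(ltW L0) // mulr_ge0 ?sqr_ge0.
have pc0 : 0 <= p ^+ 2 * c by rewrite mulr_ge0 ?sqr_ge0 // ltW.
rewrite ler_wpM2r //; apply: (@le_trans _ _ ((p ^+ 2 * c) ^+ 2)).
  have -> : (p ^+ 2 * c) ^+ 2 = p ^+ 4 * c ^+ 2 by ring.
  by rewrite ler_wpM2l //; have := sqr_ge0 c; lra.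
rewrite (exprM a 2 2) lerXn2r ?nnegrE ?sqr_ge0 //.
(* The 32 in [c] is chosen to exceed [p = 24]. *)
have -> : p ^+ 2 * c = (p / 32) ^+ 2 * a ^+ 2 by rewrite /c; field.
rewrite ler_piMl ?sqr_ge0 // expr_le1 //; rewrite pE; lra.
Qed.

Theorem theorem8 (R : realType) :
  [/\ exists2 c : R, 0 < c &
        forall (n : nat) (eps delta : R) (S : sampling R n),
          (2 <= n)%N -> 0 < eps < 1 -> 0 < delta < 1 ->
          ~ exists T : stopping_rule n,
              delta_correct S eps delta T /\
              stops_within S eps delta T (fun r =>
                c * (Num.sqrt (n%:R * ln (1 / (3 * delta))) / r ^+ 2)),
      exists2 c : R, 0 < c &
        forall (n : nat) (eps delta : R) (S : sampling R n),
          (2 <= n)%N -> 0 < eps < 1 -> 0 < delta < 1 ->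
          ~ exists T : stopping_rule n,
              delta_correct S eps delta T /\
              stops_within S eps delta T (fun r =>
                c * (ln (1 / (3 * delta)) / r ^+ 2)) &
      (* c must depend on an upper bound eps0 < 1 of eps here: with c uniform
         over all eps < 1 the clause is false, as O(sqrt n) samples suffice when
         eps is close enough to 1 (look for a cross-collision x_i = y_j). *)
      forall eps0 : R, 0 < eps0 < 1 -> exists2 c : R, 0 < c &
        forall (n : nat) (eps delta : R) (S : sampling R n),
          (2 <= n)%N -> 0 < eps <= eps0 -> 0 < delta < 1 ->
          ~ exists T : stopping_rule n,
              delta_correct S eps delta T /\
              stops_within S eps delta T (fun r =>
                c * (n%:R `^ (2 / 3) * cbrt (ln (1 / (3 * delta)))
                     / r `^ (4 / 3)))].
Proof.
split.
- exists 20^-1 => [|n eps delta S n2 e01 d01 [T [Tc Ts]]]; first by rewrite invr_gt0.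
  have /andP[e0 e1] := e01; have /andP[_ d1] := d01.
  have b1 := bound_ge1 n2 e1 d1 Tc Ts; have sep := rule_separates n2 e1 d1 Tc Ts.
  have mb := truncn_le (20^-1 * (Num.sqrt (n%:R * ln (1 / (3 * delta))) / eps ^+ 2)).
  rewrite /= (le_trans ler01 b1) in mb.
  have [L0 XL] := collision_budget (ltnW n2) e0 b1 mb.
  exact: second_moment_too_small d01 L0 XL (separates_collision n2 e01 d01 sep).
(* This constant cancels the 8 in the exponent of [separates_index]. *)
- exists 8^-1 => [|n eps delta S n2 e01 d01 [T [Tc Ts]]]; first by rewrite invr_gt0.
  have /andP[e0 e1] := e01; have /andP[_ d1] := d01.
  have b1 := bound_ge1 n2 e1 d1 Tc Ts; have sep := rule_separates n2 e1 d1 Tc Ts.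
  have mb := truncn_le (8^-1 * (ln (1 / (3 * delta)) / eps ^+ 2)).
  move: sep mb; rewrite /= (le_trans ler01 b1).
  set m := Num.truncn _ => sep; rewrite mulrA ler_pdivlMr ?exprn_gt0 // => mb.
  have L0 : 0 < ln (1 / (3 * delta)).
    by move: b1; rewrite /= mulrA ler_pdivlMr ?exprn_gt0 // mul1r;
      have := exprn_gt0 2 e0; lra.
  apply: (second_moment_too_small d01 L0 _ (separates_index n2 e01 d01 sep)).
  by rewrite -mulrA; lra.
move=> eps0 e001; pose a := eps0 * ((1 - eps0) / 2).
have /andP[e00 e01] := e001.
have c0 : 0 < (a / 32) ^+ 2.
  by rewrite exprn_gt0 // divr_gt0 ?ltr0n // mulr_gt0 // divr_gt0 // subr_gt0.
exists ((a / 32) ^+ 2) => // n eps delta S n2 ee0 d01 [T [Tc Ts]].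
have /andP[ep le0] := ee0; have /andP[_ d1] := d01; have e1 := le_lt_trans le0 e01.
have b1 := bound_ge1 n2 e1 d1 Tc Ts; have sep := rule_separates n2 e1 d1 Tc Ts.
have b0 := le_trans ler01 b1.
have mb := truncn_le ((a / 32) ^+ 2 *
  (n%:R `^ (2 / 3) * cbrt (ln (1 / (3 * delta))) / eps `^ (4 / 3))).
rewrite /= b0 in mb.
have [L0 mL] := cbrt_bound_cube ep c0 b1 mb.
have m0 : (0 < Num.truncn ((a / 32) ^+ 2 *
  (n%:R `^ (2 / 3) * cbrt (ln (1 / (3 * delta))) / eps `^ (4 / 3))))%N.
  by rewrite truncn_ge_nat.
have [X XL hX] := mixed_budget n2 m0 e001 ee0 d01 L0 mL sep.
exact: second_moment_too_small d01 L0 XL hX.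
Qed.
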